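(* Let $\mathcal{A}$ be a superspace equipped with two even bilinear operations $\circ$ and $[\cdot,\cdot]$, and an even linear selfmap $\alpha$. Let $\mathcal{R}=\mathbb{C}[\partial]\mathcal{A}$ be the free $\mathbb{C}[\partial]$-module over $\mathcal{A}$. Extend $\alpha$ to $\mathcal{R}$ by $$\alpha(f(\partial)u)=f(\partial)\alpha(u),\qquad\forall\, f(\partial)\in\mathbb{C}[\partial],\ u\in\mathcal{A},$$ and define a $\lambda$-bracket $[\cdot_\lambda\cdot]:\mathcal{A}\otimes\mathcal{A}\to\mathbb{C}[\lambda]\otimes\mathcal{R}$ by $$[u_\lambda v]=[v,u]+(\partial+\lambda)(v\circ u)+(-1)^{|u||v|}\lambda(u\circ v)\qquad\text{for homogeneous } u,v\in\mathcal{A},$$ extended to $\mathcal{R}$ by $[f(\partial)u_\lambda h(\partial)v]=f(-\lambda)h(\partial+\lambda)[u_\lambda v]$ for $f(\partial),h(\partial)\in\mathbb{C}[\partial]$, $u,v\in\mathcal{A}$. Then $(\mathcal{R},[\cdot_\lambda\cdot],\alpha)$ is a quadratic Hom-Lie conformal superalgebra if and only if $(\mathcal{A},[\cdot,\cdot],\circ,\alpha)$ is a super Hom-Gel'fand-Dorfman bialgebra.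
   Context: All linear spaces and tensor products are over $\mathbb{C}$. A superspace is a $\mathbb{Z}_2$-graded linear space $\mathcal{A}=\mathcal{A}_0\oplus\mathcal{A}_1$; $|x|\in\{0,1\}$ is the parity of a homogeneous element $x$. Formulas containing $|x|$ are stated for homogeneous elements and extended by linearity. The free module $\mathbb{C}[\partial]\mathcal{A}=\mathbb{C}[\partial]\otimes\mathcal{A}$ is graded by the grading of $\mathcal{A}$ ($\partial$ is even). Hom-Lie conformal superalgebra $(\mathcal{R},[\cdot_\lambda\cdot],\alpha)$: a $\mathbb{Z}_2$-graded $\mathbb{C}[\partial]$-module $\mathcal{R}=\mathcal{R}_0\oplus\mathcal{R}_1$ with an even linear selfmap $\alpha$ satisfying $\alpha\partial=\partial\alpha$ and a $\mathbb{C}$-bilinear map $\mathcal{R}\otimes\mathcal{R}\to\mathbb{C}[\lambda]\otimes\mathcal{R}$, $a\otimes b\mapsto[a_\lambda b]$, such that for all homogeneous $a,b,c\in\mathcal{R}$: (i) $[\partial a_\lambda b]=-\lambda[a_\lambda b]$ and $[a_\lambda\partial b]=(\partial+\lambda)[a_\lambda b]$; (ii) $[a_\lambda b]=-(-1)^{|a||b|}[b_{-\lambda-\partial}a]$, where $-\lambda-\partial$ is substituted for the variable, with $\partial$ acting on the coefficients in $\mathcal{R}$; (iii) $[\alpha(a)_\lambda[b_\mu c]]=[[a_\lambda b]_{\lambda+\mu}\alpha(c)]+(-1)^{|a||b|}[\alpha(b)_\mu[a_\lambda c]]$. It is called quadratic if $\mathcal{R}=\mathbb{C}[\partial]V$ is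 a free $\mathbb{C}[\partial]$-module over a superspace $V$ and for all $a,b\in V$ the $\lambda$-bracket has the form $[a_\lambda b]=\partial u+\lambda v+w$ with $u,v,w\in V$. Hom-Lie superalgebra $(\mathcal{A},[\cdot,\cdot],\alpha)$: a superspace with an even bilinear map $[\cdot,\cdot]:\mathcal{A}\times\mathcal{A}\to\mathcal{A}$ and an even linear map $\alpha:\mathcal{A}\to\mathcal{A}$ such that for all homogeneous $x,y,z$: $[x,y]=-(-1)^{|x||y|}[y,x]$ and $(-1)^{|x||z|}[[x,y],\alpha(z)]+(-1)^{|x||y|}[[y,z],\alpha(x)]+(-1)^{|y||z|}[[z,x],\alpha(y)]=0$. Hom-Novikov superalgebra $(\mathcal{A},\circ,\alpha)$: a superspace with an even bilinear operation $\circ$ and an even linear map $\alpha$ such that for all homogeneous $x,y,z$: $(x\circ y)\circ\alpha(z)-\alpha(x)\circ(y\circ z)=(-1)^{|x||y|}\big((y\circ x)\circ\alpha(z)-\alpha(y)\circ(x\circ z)\big)$ and $(x\circ y)\circ\alpha(z)=(-1)^{|y||z|}(x\circ z)\circ\alpha(y)$. Super Hom-Gel'fand-Dorfman bialgebra $(\mathcal{A},[\cdot,\cdot],\circ,\alpha)$: a superspace with an even linear map $\alpha$ and two operations such that $(\mathcal{A},[\cdot,\cdot],\alpha)$ is a Hom-Lie superalgebra, $(\mathcal{A},\circ,\alpha)$ is a Hom-Novikov superalgebra, and for all homogeneous $x,y,z$: $[x\circ y,\alpha(z)]-(-1)^{|y||z|}[x\circ z,\alpha(y)]+[x,y]\circ\alpha(z)-(-1)^{|y||z|}[x,z]\circ\alpha(y)-\alpha(x)\circ[y,z]=0$.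 *)

(* Defs.v *)
From HB Require Import structures.
From mathcomp Require Import all_boot all_order all_algebra.
From mathcomp Require Import finmap.
From mathcomp Require Import monalg.
From mathcomp Require Import reals complex.

Set Implicit Arguments.
Unset Strict Implicit.
Unset Printing Implicit Defensive.

Import GRing.Theory.
Local Open Scope ring_scope.

(* Superspaces: the direct sum decomposition is given by the two subspaces    *)
(* [homog false] (even) and [homog true] (odd) and the homogeneous components *)
(* [hpart i x] of a vector; these are unique by [homog_cap].                  *)
Record superspace (K : fieldType) := Superspace {
  super_sort :> lmodType K;
  homog : bool -> super_sort -> Prop;
  hpart : bool -> super_sort -> super_sort;
  homog0 : forall i, homog i 0;
  homogP : forall i c x y, homog i x -> homog i y -> homog i (c *: x + y);
  homog_cap : forall x, homog false x -> homog true x -> x = 0;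
  hpart_homog : forall i x, homog i (hpart i x);
  hpart_sum : forall x, hpart false x + hpart true x = x }.

Definition even_map (K : fieldType) (A B : superspace K) (f : A -> B) : Prop :=
  forall i x, homog i x -> homog i (f x).

Definition even_op (K : fieldType) (A : superspace K) (op : A -> A -> A) :
    Prop :=
  forall i j x y, homog i x -> homog j y -> homog (i (+) j) (op x y).

(* The sign (-1)^(|x||y|) for |x| = i and |y| = j.                            *)
Definition ssign (K : fieldType) (i j : bool) : K := (-1) ^+ (i && j).
Arguments ssign {K} i j.

(* [polyv V] is K[t] (x) V, the polynomials with coefficients in the vector   *)
(* space V.  The instance on [malg] in the library only scales coefficients   *)
(* lying in a ring, whence the alias.                                         *)
Definition polyv (K : fieldType) (V : lmodType K) : Type := {malg V[nat]}.

HB.instance Definition _ (K : fieldType) (V : lmodType K) :=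
  GRing.Zmodule.copy (polyv V) {malg V[nat]}.

Definition polyv_scale (K : fieldType) (V : lmodType K) (c : K)
    (p : polyv V) : polyv V := [malg n in msupp p => c *: p@_n].

Lemma polyv_scaleE (K : fieldType) (V : lmodType K) (c : K) (p : polyv V) n :
  (polyv_scale c p)@_n = c *: p@_n.
Proof. by rewrite mcoeffE; case: msuppP; rewrite ?scaler0. Qed.

Fact polyv_scaleA (K : fieldType) (V : lmodType K) (a b : K) (p : polyv V) :
  polyv_scale a (polyv_scale b p) = polyv_scale (a * b) p.
Proof. by apply/malgP=> n; rewrite !polyv_scaleE scalerA. Qed.

Fact polyv_scale1 (K : fieldType) (V : lmodType K) :
  left_id 1 (@polyv_scale K V).
Proof. by move=> p; apply/malgP=> n; rewrite polyv_scaleE scale1r. Qed.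

Fact polyv_scaleDr (K : fieldType) (V : lmodType K) :
  right_distributive (@polyv_scale K V) +%R.
Proof.
move=> a p q; apply/malgP=> n.
by rewrite polyv_scaleE [in RHS]mcoeffD !polyv_scaleE mcoeffD scalerDr.
Qed.

Fact polyv_scaleDl (K : fieldType) (V : lmodType K) (p : polyv V) :
  {morph (@polyv_scale K V)^~ p : a b / a + b}.
Proof.
move=> a b; apply/malgP=> n.
by rewrite polyv_scaleE [in RHS]mcoeffD !polyv_scaleE scalerDl.
Qed.

HB.instance Definition _ (K : fieldType) (V : lmodType K) :=
  GRing.Zmodule_isLmodule.Build K (polyv V)
    (@polyv_scaleA K V) (@polyv_scale1 K V)
    (@polyv_scaleDr K V) (@polyv_scaleDl K V).

Definition pconst (K : fieldType) (V : lmodType K) (v : V) : polyv V :=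
  << v *g 0%N >>.

(* Multiplication by the indeterminate.                                       *)
Definition pmulX (K : fieldType) (V : lmodType K) (p : polyv V) : polyv V :=
  \sum_(n <- msupp p) << p@_n *g n.+1 >>.

(* A linear map applied to the coefficients.                                  *)
Definition pmap_coef (K : fieldType) (V W : lmodType K) (f : V -> W)
    (p : polyv V) : polyv W :=
  [malg n in msupp p => f p@_n].

(* Substitution of an operator T for the indeterminate, the coefficients      *)
(* being mapped by j: if p = \sum_n t^n v_n, then                             *)
(* psubst T j p = \sum_n T^n (j v_n).                                         *)
Definition psubst (K : fieldType) (V W : lmodType K) (T : W -> W) (j : V -> W)
    (p : polyv V) : W :=
  \sum_(n <- msupp p) iter n T (j p@_n).

Section ConformalSuperalgebra.
Context {K : fieldType} {R : superspace K}.
Variables (d : R -> R) (br : R -> R -> polyv R) (al : R -> R).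

(* K[lambda, mu] (x) R, as polynomials in lambda with coefficients in         *)
(* K[mu] (x) R.                                                               *)
Local Notation R2 := (polyv (polyv R)).
Local Notation lam := (fun P : R2 => pmulX P).
Local Notation mu := (fun P : R2 => pmap_coef (@pmulX K R) P).
Local Notation cst := (fun x : R => pconst (pconst x) : R2).

(* A K[d]-module is a vector space with an endomorphism d, namely the action  *)
(* of the indeterminate.                                                      *)
Record hom_lie_conformal_superalgebra : Prop := HomLieConformal {
  hlc_d_linear : linear d;
  hlc_d_even : even_map d;
  hlc_al_linear : linear al;
  hlc_al_even : even_map al;
  hlc_al_d : forall a, al (d a) = d (al a);
  hlc_bilinear : bilinear_for *:%R *:%R br;
  hlc_sesquil : forall i j a b, homog i a -> homog j b ->
    br (d a) b = - pmulX (br a b);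
  hlc_sesquir : forall i j a b, homog i a -> homog j b ->
    br a (d b) = pmap_coef d (br a b) + pmulX (br a b);
  hlc_skew : forall i j a b, homog i a -> homog j b ->
    br a b = - (ssign i j *:
      psubst (fun P => - pmulX P - pmap_coef d P) (@pconst K R) (br b a));
  hlc_jacobi : forall i j k a b c, homog i a -> homog j b -> homog k c ->
    psubst mu (fun r => psubst lam cst (br (al a) r)) (br b c)
    = psubst lam (fun r => psubst (fun P => lam P + mu P) cst (br r (al c)))
        (br a b)
      + ssign i j *:
        psubst lam (fun r => psubst mu cst (br (al b) r)) (br a c) }.

(* The map psubst d iota sends \sum_n t^n v_n to \sum_n d^n (iota v_n), so    *)
(* its bijectivity says that R is free over (the image of) V.                 *)
Definition quadratic : Prop :=
  exists (V : superspace K) (iota : V -> R),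
    [/\ linear iota, even_map iota, bijective (psubst d iota) &
        forall a b : V, exists u v w : V,
          br (iota a) (iota b) =
            pconst (d (iota u)) + pmulX (pconst (iota v)) + pconst (iota w)].

Definition quadratic_hom_lie_conformal_superalgebra : Prop :=
  hom_lie_conformal_superalgebra /\ quadratic.

End ConformalSuperalgebra.

Section Bialgebra.
Context {K : fieldType} {A : superspace K}.
Variables (lie nov : A -> A -> A) (al : A -> A).
Local Notation "[ x , y ]" := (lie x y).
Local Notation "x \circ y" := (nov x y) (at level 40, left associativity).

Record hom_lie_superalgebra : Prop := HomLie {
  hl_bilinear : bilinear_for *:%R *:%R lie;
  hl_even : even_op lie;
  hl_al_linear : linear al;
  hl_al_even : even_map al;
  hl_skew : forall i j x y, homog i x -> homog j y ->
    [x, y] = - (ssign i j *: [y, x]);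
  hl_jacobi : forall i j k x y z, homog i x -> homog j y -> homog k z ->
    ssign i k *: [[x, y], al z] + ssign i j *: [[y, z], al x]
    + ssign j k *: [[z, x], al y] = 0 }.

Record hom_novikov_superalgebra : Prop := HomNovikov {
  hn_bilinear : bilinear_for *:%R *:%R nov;
  hn_even : even_op nov;
  hn_al_linear : linear al;
  hn_al_even : even_map al;
  hn_left_symmetric : forall i j k x y z,
    homog i x -> homog j y -> homog k z ->
    (x \circ y) \circ al z - al x \circ (y \circ z)
    = ssign i j *: ((y \circ x) \circ al z - al y \circ (x \circ z));
  hn_right_commutative : forall i j k x y z,
    homog i x -> homog j y -> homog k z ->
    (x \circ y) \circ al z = ssign j k *: ((x \circ z) \circ al y) }.

Record super_hom_gelfand_dorfman_bialgebra : Prop := HomGelfandDorfman {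
  hgd_lie : hom_lie_superalgebra;
  hgd_novikov : hom_novikov_superalgebra;
  hgd_compat : forall i j k x y z, homog i x -> homog j y -> homog k z ->
    [x \circ y, al z] - ssign j k *: [x \circ z, al y]
    + [x, y] \circ al z - ssign j k *: ([x, z] \circ al y)
    - al x \circ [y, z] = 0 }.

End Bialgebra.

Section FreeModule.
Context {K : fieldType} (A : superspace K).

Definition fhomog i (p : polyv A) : Prop := forall n, homog i p@_n.
Definition fpart i (p : polyv A) : polyv A := pmap_coef (hpart i) p.

Fact hpart0 i : hpart i (0 : A) = 0.
Proof.
have h j : homog j (hpart (~~ j) (0 : A)).
  have e : hpart (~~ j) (0 : A) = -1 *: hpart j (0 : A) + 0.
    by rewrite scaleN1r addr0; apply/eqP; rewrite -addr_eq0 addrC;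
       case: j; rewrite /= ?[hpart true _ + _]addrC hpart_sum.
  by rewrite e; apply: homogP; [apply: hpart_homog | apply: homog0].
by case: i; apply: homog_cap; rewrite ?(h false) ?(h true) //;
  apply: hpart_homog || apply: h.
Qed.

Fact fpart_coef i p n : (fpart i p)@_n = hpart i p@_n.
Proof. by rewrite mcoeffE; case: msuppP; rewrite ?hpart0. Qed.

Fact fhomog0 i : fhomog i 0.
Proof. by move=> n; rewrite mcoeff0; apply: homog0. Qed.

Fact fhomogP i c p q : fhomog i p -> fhomog i q -> fhomog i (c *: p + q).
Proof.
by move=> hp hq n; rewrite mcoeffD polyv_scaleE; apply: homogP.
Qed.

Fact fhomog_cap p : fhomog false p -> fhomog true p -> p = 0.
Proof.
by move=> h0 h1; apply/malgP=> n; rewrite mcoeff0; apply: homog_cap.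
Qed.

Fact fpart_homog i p : fhomog i (fpart i p).
Proof. by move=> n; rewrite fpart_coef; apply: hpart_homog. Qed.

Fact fpart_sum p : fpart false p + fpart true p = p.
Proof. by apply/malgP=> n; rewrite mcoeffD !fpart_coef hpart_sum. Qed.

(* K[d]A, the element \sum_n d^n u_n being the polynomial \sum_n t^n u_n, so  *)
(* that d acts as [pmulX].                                                    *)
Definition free_module : superspace K :=
  Superspace fhomog0 fhomogP fhomog_cap fpart_homog fpart_sum.

Definition free_d : free_module -> free_module := @pmulX K A.

Definition free_ext (al : A -> A) : free_module -> free_module :=
  pmap_coef al.

Variables (lie nov : A -> A -> A).

Local Notation lam := (@pmulX K free_module).
Local Notation dd := (@pmap_coef K free_module free_module free_d).
Local Notation cst := (fun u : A => @pconst K free_module (pconst u)).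

(* [u_lambda v] for u of parity i and v of parity j.                          *)
Definition gd_bracket_homog (i j : bool) (u v : A) : polyv free_module :=
  cst (lie v u) + (dd (cst (nov v u)) + lam (cst (nov v u)))
  + ssign i j *: lam (cst (nov u v)).

Definition gd_bracket_gen (u v : A) : polyv free_module :=
  \sum_(i : bool) \sum_(j : bool)
    gd_bracket_homog i j (hpart i u) (hpart j v).

(* [f(d)u_lambda h(d)v] = f(-lambda) h(d + lambda) [u_lambda v]               *)
Definition gd_bracket (x y : free_module) : polyv free_module :=
  psubst (fun P => - lam P)
    (fun u => psubst (fun P => dd P + lam P) (gd_bracket_gen u) y) x.

End FreeModule.

Arguments free_d {K} A x.
Arguments gd_bracket {K A} lie nov x y.
Arguments free_ext {K A} al x.

(* Main.v *)
(* Skew-symmetry and the Jacobi identity hold on K[d]A as soon as they hold on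
   homogeneous elements of A, since the two defects are additive and turn d,
   applied to an argument, into -lambda, -mu or d + lambda + mu.  For a, b, c
   in A the Jacobi defect is a polynomial of degree two in d, lambda, mu with
   ten coefficients in A.  The coefficients of d^2, lambda^2, d and 1 amount to
   right commutativity, left symmetry, the compatibility condition and the
   Hom-Jacobi identity; the other six are combinations of instances of these
   axioms, with signs.  These sign-dependent identities are all checked by
   reflection. *)

Require Import Defs.
From HB Require Import structures.
From mathcomp Require Import all_boot all_order all_algebra.
From mathcomp Require Import finmap monalg.
From mathcomp Require Import reals complex.

Set Implicit Arguments.
Unset Strict Implicit.
Unset Printing Implicit Defensive.

Import GRing.Theory.
Local Open Scope ring_scope.

(** * Polynomials with vector coefficients *)

(** Two obstacles shape the proof. In the Jacobi identity different expressions, lambda, mu and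
    lambda + mu, are substituted for the variables of doubly nested brackets. Brackets are therefore
    evaluated in an arbitrary vector space [W] with commuting operators standing for lambda, mu and
    d; substituting an expression means choosing an operator, and polynomials in lambda and mu over
    K[d]A enter only at the end, where coefficients are compared. The substitution of -lambda - d in
    skew-symmetry obeys the same rules. The other obstacle is the signs. Parities are quantified,
    not computed, so [ssign i k], [ssign k i] and [ssign i (j (+) k)] occur side by side. They stay
    symbolic until an identity is decided for every pattern of parities, which replaces any calculus
    of signs. *)

Section LinearFor.
Context {K : fieldType} {U V : lmodType K} (f : U -> V) (fL : linear f).

Let F : {linear U -> V} := HB.pack f (GRing.isLinear.Build K U V *:%R f fL).

Lemma lin0 : f 0 = 0. Proof. exact: (linear0 F). Qed.
Lemma linN x : f (- x) = - f x. Proof. exact: (linearN F). Qed.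
Lemma linD x y : f (x + y) = f x + f y. Proof. exact: (linearD F). Qed.
Lemma linZ c x : f (c *: x) = c *: f x. Proof. exact: (linearZ_LR F). Qed.

Lemma linear_iter (g : U -> U) : linear g -> forall n, linear (iter n g).
Proof. by move=> gL; elim=> [//|n IHn] c x y; rewrite !iterS IHn gL. Qed.

Lemma linear_opp_fun : linear (fun x => - f x).
Proof. by move=> c x y; rewrite fL opprD scalerN. Qed.

Lemma linear_add_fun (g : U -> V) : linear g -> linear (fun x => f x + g x).
Proof. by move=> gL c x y; rewrite fL gL scalerDr addrACA. Qed.

Lemma linear_scale_fun (a : K) : linear (fun x => a *: f x).
Proof. by move=> c x y; rewrite fL scalerDr !scalerA mulrC. Qed.

Lemma linear_comp_fun (W : lmodType K) (g : W -> U) :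
  linear g -> linear (fun x => f (g x)).
Proof. by move=> gL c x y; rewrite gL fL. Qed.

End LinearFor.

Lemma linear_sum_fun (K : fieldType) (U V : lmodType K) (I : finType)
    (f : I -> U -> V) :
  (forall i, linear (f i)) -> linear (fun x => \sum_i f i x).
Proof.
move=> fL c x y; rewrite scaler_sumr -big_split /=.
by apply: eq_bigr => i _; rewrite fL.
Qed.

Lemma sum_bool_eq (V : zmodType) (i : bool) (F : bool -> V) :
  (forall j, i != j -> F j = 0) -> \sum_j F j = F i.
Proof.
move=> h; rewrite (bigD1 i) //= big1 ?addr0 // => j.
by rewrite eq_sym => /h.
Qed.

Section VectorPolynomials.
Context {K : fieldType}.
Implicit Types U V W : lmodType K.

Lemma pmulXE V (p : polyv V) n :
  (pmulX p)@_n = if n is m.+1 then p@_m else 0.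
Proof.
rewrite raddf_sum /=; case: n => [|n].
  by rewrite big1 // => i _; rewrite mcoeffU.
rewrite [in RHS](monalgE p) raddf_sum /=.
by apply: eq_bigr => i _; rewrite !mcoeffU eqSS.
Qed.

Lemma pmap_coefE V W (f : V -> W) (p : polyv V) n :
  f 0 = 0 -> (pmap_coef f p)@_n = f p@_n.
Proof. by move=> f0; rewrite mcoeffE; case: msuppP; rewrite ?f0. Qed.

Lemma pconstE V (v : V) n : (pconst v)@_n = if n is 0 then v else 0.
Proof. by rewrite mcoeffU; case: n. Qed.

Lemma pconst_linear V : linear (@pconst K V).
Proof.
move=> c u v; apply/malgP=> n.
by rewrite mcoeffD polyv_scaleE !pconstE; case: n; rewrite ?scaler0 ?addr0.
Qed.

Lemma pmulX_linear V : linear (@pmulX K V).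
Proof.
move=> c p q; apply/malgP=> n.
rewrite mcoeffD polyv_scaleE !pmulXE; case: n => [|n].
  by rewrite scaler0 addr0.
by rewrite mcoeffD polyv_scaleE.
Qed.

Lemma pmap_coef_linear V W (f : V -> W) :
  linear f -> linear (@pmap_coef K V W f).
Proof.
move=> fL c p q; apply/malgP=> n.
by rewrite mcoeffD polyv_scaleE !(pmap_coefE _ _ (lin0 fL)) mcoeffD
  polyv_scaleE fL.
Qed.

HB.instance Definition _ V :=
  GRing.isLinear.Build K V (polyv V) *:%R (@pconst K V) (@pconst_linear V).
HB.instance Definition _ V :=
  GRing.isLinear.Build K (polyv V) (polyv V) *:%R (@pmulX K V)
    (@pmulX_linear V).

Lemma pmap_coef_mulX V W (f : V -> W) (p : polyv V) :
  linear f -> pmap_coef f (pmulX p) = pmulX (pmap_coef f p).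
Proof.
move=> fL; apply/malgP=> n; have f0 := lin0 fL.
by rewrite pmap_coefE // !pmulXE; case: n => [//|n]; rewrite pmap_coefE.
Qed.

Lemma pmap_coef_const V W (f : V -> W) (v : V) :
  linear f -> pmap_coef f (pconst v) = pconst (f v).
Proof.
move=> fL; apply/malgP=> n; have f0 := lin0 fL.
by rewrite pmap_coefE // !pconstE; case: n.
Qed.

(** The predicate [H] carries the parity: a homogeneous element of K[d]A is one whose coefficients
    all have the same parity. *)
Lemma polyv_ind_in V (H : V -> Prop) (P : polyv V -> Prop) :
    P 0 -> (forall p q, P p -> P q -> P (p + q)) ->
    (forall p, P p -> P (pmulX p)) -> (forall v, H v -> P (pconst v)) ->
  forall p : polyv V, (forall n, H p@_n) -> P p.
Proof.
move=> P0 PD PX PC p Hp; rewrite [p]monalgE.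
apply: (big_ind P) => // n _; move: (p@_n) (Hp n) => v Hv.
elim: n => [|n IHn]; first exact: PC.
suff -> : << v *g n.+1 >> = pmulX << v *g n >> by apply: PX.
by apply/malgP => -[|m]; rewrite pmulXE !mcoeffU // eqSS.
Qed.

Lemma polyv_ind V (P : polyv V -> Prop) :
    P 0 -> (forall p q, P p -> P q -> P (p + q)) ->
    (forall p, P p -> P (pmulX p)) -> (forall v, P (pconst v)) ->
  forall p : polyv V, P p.
Proof. by move=> P0 PD PX PC p; apply: (@polyv_ind_in V xpredT). Qed.

Section Substitution.
Context {V W : lmodType K} {T : W -> W} {j : V -> W}.
Hypotheses (TL : linear T) (jL : linear j).

Local Lemma iter_psubst0 n : iter n T (j 0) = 0.
Proof. by rewrite (lin0 jL) (lin0 (linear_iter TL n)). Qed.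

(** Supports change under sums and maps; since [j 0 = 0], the sum may run over any larger index set,
    so that different polynomials can be compared termwise. *)
Lemma psubst_wide (B : {fset nat}) (p : polyv V) : (msupp p `<=` B)%fset ->
  psubst T j p = \sum_(n <- B) iter n T (j p@_n).
Proof.
move=> sB; apply: big_fset_incl => // n _ /mcoeff_outdom ->.
exact: iter_psubst0.
Qed.

Lemma psubst_linear : linear (psubst T j).
Proof.
move=> c p q; pose B := (msupp p `|` msupp q `|` msupp (c *: p + q))%fset.
have sB r : [|| r == p, r == q | r == c *: p + q] -> (msupp r `<=` B)%fset.
  case/or3P=> /eqP->; apply/fsubsetP => n; rewrite !in_fsetU => ->;
    by rewrite ?orbT.
rewrite !(@psubst_wide B) ?sB ?eqxx ?orbT //.
rewrite scaler_sumr -big_split /=; apply: eq_bigr => n _.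
by rewrite mcoeffD polyv_scaleE jL (linear_iter TL).
Qed.

Lemma psubstU v n : psubst T j << v *g n >> = iter n T (j v).
Proof.
by rewrite (psubst_wide msuppU_le) big_seq_fset1 mcoeffUU.
Qed.

Lemma psubst_const v : psubst T j (pconst v) = j v.
Proof. exact: psubstU. Qed.

Lemma psubst_mulX p : psubst T j (pmulX p) = T (psubst T j p).
Proof.
have psL := psubst_linear.
rewrite [p in RHS]monalgE /pmulX.
elim/big_rec2: _ => [|n x y _ IH]; first by rewrite (lin0 psL) (lin0 TL).
by rewrite !(linD psL) (linD TL) IH !psubstU.
Qed.

(** [S] passes every power of [T]. This pulls out the operator, such as [- T] or [D + T], that d
    produces inside a nested substitution. *)
Lemma psubst_comm (S : W -> W) p : linear S -> (forall x, S (T x) = T (S x)) ->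
  psubst T (fun v => S (j v)) p = S (psubst T j p).
Proof.
move=> SL ST; rewrite /psubst; elim/big_rec2: _ => [|n x y _ ->].
  by rewrite (lin0 SL).
rewrite (linD SL); congr (_ + _).
by move: (j _) => v; elim: n => [//|n IHn]; rewrite !iterS IHn ST.
Qed.

Lemma psubst_map U (f : U -> V) p : linear f ->
  psubst T j (pmap_coef f p) = psubst T (fun u => j (f u)) p.
Proof.
move=> fL; rewrite (@psubst_wide (msupp p)) /psubst; last first.
  apply/fsubsetP => n; rewrite -!mcoeff_neq0 pmap_coefE ?(lin0 fL) //.
  by apply: contra_neq => ->; rewrite (lin0 fL).
by apply: eq_bigr => n _; rewrite pmap_coefE ?(lin0 fL).
Qed.

End Substitution.

Lemma psubst_linear_coef V W (T : W -> W) (j j' : V -> W) (c : K) p :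
  linear T ->
  psubst T (fun v => c *: j v + j' v) p = c *: psubst T j p + psubst T j' p.
Proof.
move=> TL; rewrite /psubst scaler_sumr -big_split /=.
by apply: eq_bigr => n _; rewrite (linear_iter TL).
Qed.

Lemma eq_psubst V W (T : W -> W) (j j' : V -> W) p :
  j =1 j' -> psubst T j p = psubst T j' p.
Proof. by move=> e; apply: eq_bigr => n _; rewrite e. Qed.

End VectorPolynomials.

(** * Iterated lambda-brackets *)

Section NestedBrackets.
Context {K : fieldType} {R W : lmodType K}.
Variables (d : R -> R) (br : R -> R -> polyv R).
Hypotheses (dL : linear d) (brL : bilinear_for *:%R *:%R br).
Hypothesis sesquil : forall x y, br (d x) y = - pmulX (br x y).
Hypothesis sesquir : forall x y,
  br x (d y) = pmap_coef d (br x y) + pmulX (br x y).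
Variables (S T D : W -> W) (c : R -> W).
Hypotheses (SL : linear S) (TL : linear T) (DL : linear D) (cL : linear c).
Hypotheses (ST : forall x, S (T x) = T (S x)) (DS : forall x, D (S x) = S (D x))
  (DT : forall x, D (T x) = T (D x)) (cd : forall x, c (d x) = D (c x)).

(** This and the next definition are the brackets [x_T [y_S z]] and [[x_S y]_T z] with values in
    [W]: [c] embeds the constants and turns d into [D], and [S] and [T] replace the variables of the
    inner and the outer bracket. *)
Definition nested_right x y z :=
  psubst S (fun r => psubst T c (br x r)) (br y z).
Definition nested_left x y z :=
  psubst S (fun r => psubst T c (br r z)) (br x y).

Let brlL z : linear (br^~ z). Proof. by move=> a x y; rewrite (brL.1 z). Qed.
Let brrL x : linear (br x). Proof. by move=> a y z; rewrite (brL.2 x). Qed.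
Let cTL : linear (psubst T c). Proof. exact: psubst_linear. Qed.
Let cTlL z : linear (fun r => psubst T c (br r z)).
Proof. by move=> a x y; rewrite brlL cTL. Qed.
Let cTrL x : linear (fun r => psubst T c (br x r)).
Proof. by move=> a y z; rewrite brrL cTL. Qed.

Lemma psubst_dr x y :
  psubst T c (br x (d y)) = D (psubst T c (br x y)) + T (psubst T c (br x y)).
Proof.
rewrite sesquir (linD cTL) psubst_mulX // psubst_map //; congr (_ + _).
by rewrite (eq_psubst _ _ cd) psubst_comm.
Qed.

Lemma psubst_dl x y : psubst T c (br (d x) y) = - T (psubst T c (br x y)).
Proof. by rewrite sesquil (linN cTL) psubst_mulX. Qed.

Lemma nested_right_linear1 y z : linear (fun x => nested_right x y z).
Proof.
move=> a x x'; rewrite /nested_right -psubst_linear_coef //.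
by apply: eq_psubst => r; rewrite brlL cTL.
Qed.

Lemma nested_right_linear2 x z : linear (fun y => nested_right x y z).
Proof. by move=> a y y'; rewrite /nested_right brlL psubst_linear. Qed.

Lemma nested_right_linear3 x y : linear (fun z => nested_right x y z).
Proof. by move=> a z z'; rewrite /nested_right brrL psubst_linear. Qed.

Lemma nested_right_d1 x y z : nested_right (d x) y z = - T (nested_right x y z).
Proof.
rewrite /nested_right (eq_psubst _ _ (psubst_dl x)).
have NL : linear (fun P => - T P).
  by move=> a P Q; rewrite TL opprD scalerN.
by rewrite -(psubst_comm (S := fun P => - T P)) // => P; rewrite (linN SL) ST.
Qed.

Lemma nested_right_d2 x y z : nested_right x (d y) z = - S (nested_right x y z).
Proof.
by rewrite /nested_right sesquil (linN (psubst_linear SL (cTrL x))) psubst_mulX.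
Qed.

Lemma nested_right_d3 x y z : nested_right x y (d z) =
  D (nested_right x y z) + T (nested_right x y z) + S (nested_right x y z).
Proof.
rewrite /nested_right sesquir (linD (psubst_linear SL (cTrL x))) psubst_mulX //.
congr (_ + _); rewrite psubst_map // (eq_psubst _ _ (psubst_dr x)).
rewrite -(psubst_comm (S := fun P => D P + T P)) //.
- by move=> a P Q; rewrite DL TL scalerDr addrACA.
- by move=> P; rewrite DS -ST (linD SL).
Qed.

Lemma nested_left_linear1 y z : linear (fun x => nested_left x y z).
Proof. by move=> a x x'; rewrite /nested_left brlL psubst_linear. Qed.

Lemma nested_left_linear2 x z : linear (fun y => nested_left x y z).
Proof. by move=> a y y'; rewrite /nested_left brrL psubst_linear. Qed.

Lemma nested_left_linear3 x y : linear (fun z => nested_left x y z).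
Proof.
move=> a z z'; rewrite /nested_left -psubst_linear_coef //.
by apply: eq_psubst => r; rewrite brrL cTL.
Qed.

Lemma nested_left_d1 x y z : nested_left (d x) y z = - S (nested_left x y z).
Proof.
by rewrite /nested_left sesquil (linN (psubst_linear SL (cTlL z))) psubst_mulX.
Qed.

Lemma nested_left_d2 x y z :
  nested_left x (d y) z = S (nested_left x y z) - T (nested_left x y z).
Proof.
rewrite /nested_left sesquir (linD (psubst_linear SL (cTlL z))) psubst_mulX //.
rewrite addrC; congr (_ + _).
rewrite psubst_map // (eq_psubst _ _ (psubst_dl^~ z)).
have NL : linear (fun P => - T P).
  by move=> a P Q; rewrite TL opprD scalerN.
by rewrite -(psubst_comm (S := fun P => - T P)) // => P; rewrite (linN SL) ST.
Qed.

Lemma nested_left_d3 x y z : nested_left x y (d z) =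
  D (nested_left x y z) + T (nested_left x y z).
Proof.
rewrite /nested_left (eq_psubst _ _ (psubst_dr^~ z)).
rewrite -(psubst_comm (S := fun P => D P + T P)) //.
- by move=> a P Q; rewrite DL TL scalerDr addrACA.
- by move=> P; rewrite DS -ST (linD SL).
Qed.

End NestedBrackets.

(** * Uniqueness and linearity of homogeneous components *)

Section Superspaces.
Context {K : fieldType} (A : superspace K).

Lemma homogD i (x y : A) : homog i x -> homog i y -> homog i (x + y).
Proof. by move=> hx hy; rewrite -[x]scale1r; apply: homogP. Qed.

Lemma homogZ i c (x : A) : homog i x -> homog i (c *: x).
Proof. by move=> hx; rewrite -[_ *: _]addr0; apply/homogP/homog0. Qed.

(** The even vector [hpart false x - y] equals the odd vector [z - hpart true x], hence both
    vanish. *)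
Lemma hpart_unique (x y z : A) : homog false y -> homog true z -> y + z = x ->
  hpart false x = y /\ hpart true x = z.
Proof.
move=> hy hz e; have e' : hpart false x - y = z - hpart true x.
  by apply/eqP; rewrite subr_eq addrAC eq_sym subr_eq hpart_sum [z + y]addrC e.
have h0 : hpart false x - y = 0.
  apply: homog_cap; last rewrite e'; rewrite -scaleN1r;
    by [apply/homogD/homogZ => //; apply: hpart_homog].
split; apply/eqP; first by rewrite -subr_eq0 h0.
by rewrite eq_sym -subr_eq0 -e' h0.
Qed.

Lemma hpart_linear i : linear (@hpart K A i).
Proof.
move=> c x y; have hh j u : homog j (hpart j (u : A)) by apply: hpart_homog.
have [|||e0 e1] := @hpart_unique (c *: x + y)
    (c *: hpart false x + hpart false y) (c *: hpart true x + hpart true y).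
- exact: homogP.
- exact: homogP.
- by rewrite addrACA -scalerDr !hpart_sum.
by case: i.
Qed.

Lemma hpart_homogE i j (x : A) :
  homog i x -> hpart j x = if i == j then x else 0.
Proof.
move=> hx; have h0 k := @homog0 K A k; case: i hx => hx.
  by have [] := hpart_unique (h0 false) hx (add0r x); case: j.
by have [] := hpart_unique hx (h0 true) (addr0 x); case: j.
Qed.

End Superspaces.

(** * The lambda-bracket on generators and its sesquilinear extension *)

Section GelfandDorfmanBracket.
Context {K : fieldType} {A : superspace K}.
Variables lie nov : {bilinear A -> A -> A}.

Local Notation free := (free_module A).
Local Notation lam := (@pmulX K free).
Local Notation dd := (@pmap_coef K free free (free_d A)).
Local Notation br := (gd_bracket lie nov).

Lemma free_d_linear : linear (free_d A). Proof. exact: pmulX_linear. Qed.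

Let ddL : linear dd. Proof. exact: pmap_coef_linear free_d_linear. Qed.
Let lamL : linear lam. Proof. exact: pmulX_linear. Qed.
Let dlamL : linear (fun P => dd P + lam P). Proof. exact: linear_add_fun. Qed.
Let nlamL : linear (fun P => - lam P). Proof. exact: linear_opp_fun. Qed.

Let dd_lam P : dd (lam P) = lam (dd P).
Proof. exact: pmap_coef_mulX free_d_linear. Qed.

Let cst : A -> polyv free := fun u => @pconst K free (pconst u).
Let cstL : linear cst.
Proof.
exact: (linear_comp_fun (@pconst_linear K free) (@pconst_linear K A)).
Qed.
Let lieL u : linear (lie u). Proof. by move=> *; apply: linearPr. Qed.
Let lieLl u : linear (lie^~ u). Proof. by move=> *; apply: linearPl. Qed.
Let novL u : linear (nov u). Proof. by move=> *; apply: linearPr. Qed.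
Let novLl u : linear (nov^~ u). Proof. by move=> *; apply: linearPl. Qed.

(** Fixing either argument of the bracket leaves an expression of this shape, so both halves of
    bilinearity follow from it. *)
Let gd_linear f g h (s : K) : linear f -> linear g -> linear h ->
  linear (fun u : A => cst (f u) + (dd (cst (g u)) + lam (cst (g u)))
    + s *: lam (cst (h u))).
Proof.
move=> fL gL hL; do 2?apply: linear_add_fun; first exact: linear_comp_fun.
  exact: (linear_comp_fun (linear_comp_fun dlamL cstL) gL).
exact/linear_scale_fun/(linear_comp_fun (linear_comp_fun lamL cstL) hL).
Qed.

Lemma gd_bracket_homog_bilinear i j :
  bilinear_for *:%R *:%R (gd_bracket_homog lie nov i j).
Proof. by split=> u; apply: gd_linear. Qed.

Lemma gd_bracket_gen_bilinear : bilinear_for *:%R *:%R (gd_bracket_gen lie nov).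
Proof.
have hL i := @hpart_linear K A i.
have gl i j v : linear (fun u => gd_bracket_homog lie nov i j (hpart i u) v).
  exact: (linear_comp_fun ((gd_bracket_homog_bilinear i j).1 v) (hL i)).
have gr i j u : linear (fun v => gd_bracket_homog lie nov i j u (hpart j v)).
  exact: (linear_comp_fun ((gd_bracket_homog_bilinear i j).2 u) (hL j)).
split=> u; apply: linear_sum_fun => i; apply: linear_sum_fun => j.
  exact: gl.
exact: gr.
Qed.

Lemma gd_bracket_genE i j u v : homog i u -> homog j v ->
  gd_bracket_gen lie nov u v = gd_bracket_homog lie nov i j u v.
Proof.
move=> hu hv; have gB i' j' := gd_bracket_homog_bilinear i' j'.
have g0l i' j' x : gd_bracket_homog lie nov i' j' 0 x = 0.
  exact: lin0 ((gB i' j').1 x).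
have g0r i' j' x : gd_bracket_homog lie nov i' j' x 0 = 0.
  exact: lin0 ((gB i' j').2 x).
rewrite /gd_bracket_gen (sum_bool_eq (i := i)) => [|i' ne].
  rewrite (sum_bool_eq (i := j)) => [|j' ne].
    by rewrite !(hpart_homogE _ hu, hpart_homogE _ hv) !eqxx.
  by rewrite (hpart_homogE _ hv) (negPf ne) g0r.
rewrite (sum_bool_eq (i := j)) => [|j' _];
  by rewrite (hpart_homogE _ hu) (negPf ne) g0l.
Qed.

Let genl v : linear (fun u => gd_bracket_gen lie nov u v).
Proof. exact: gd_bracket_gen_bilinear.1. Qed.
Let genr u : linear (gd_bracket_gen lie nov u).
Proof. exact: gd_bracket_gen_bilinear.2. Qed.

Let inner_linear y : linear (fun u =>
  psubst (fun P => dd P + lam P) (gd_bracket_gen lie nov u) y).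
Proof.
move=> c u v; rewrite -psubst_linear_coef //.
by apply: eq_psubst => w; rewrite genl.
Qed.

Lemma gd_bracket_bilinear : bilinear_for *:%R *:%R br.
Proof.
split=> [y|x] c u v; rewrite /gd_bracket; first exact: psubst_linear.
rewrite -psubst_linear_coef //; apply: eq_psubst => w.
exact: psubst_linear.
Qed.

Lemma gd_bracket_dl x y : br (free_d A x) y = - pmulX (br x y).
Proof. exact: psubst_mulX. Qed.

(** The new factor [dd + lam] appears inside the substitution of [- lam] for the left argument; the
    two operators commute, so it moves out. *)
Lemma gd_bracket_dr x y :
  br x (free_d A y) = pmap_coef (free_d A) (br x y) + pmulX (br x y).
Proof.
rewrite /gd_bracket -(psubst_comm (S := fun P => dd P + lam P)) //.
  by apply: eq_psubst => u; rewrite psubst_mulX.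
by move=> P; rewrite (linN ddL) !(linN lamL) (linD lamL) dd_lam opprD.
Qed.

Lemma gd_bracket_const u v :
  br (pconst u) (pconst v) = gd_bracket_gen lie nov u v.
Proof. by rewrite /gd_bracket psubst_const // psubst_const. Qed.

(** The map [g] will be an embedding of constants for a single bracket, and an outer bracket
    followed by a substitution for a double one. *)
Lemma psubst_gd_bracket (W : lmodType K) (S : W -> W) (g : free -> W) i j u v :
  linear S -> linear g ->
  psubst S g (gd_bracket_homog lie nov i j u v) =
    g (pconst (lie v u)) +
    (g (free_d A (pconst (nov v u))) + S (g (pconst (nov v u)))) +
    ssign i j *: S (g (pconst (nov u v))).
Proof.
move=> SL gL; have psL := psubst_linear SL gL.
have psE x y z w (s : K) : psubst S g (x + (y + z) + s *: w) =
    psubst S g x + (psubst S g y + psubst S g z) + s *: psubst S g w.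
  by rewrite (linD psL) (linZ psL) (linD psL) (linD psL).
have psX z : psubst S g (lam (pconst z)) = S (g z).
  by rewrite psubst_mulX // psubst_const.
rewrite /gd_bracket_homog psE.
congr (_ + (_ + _) + _ *: _); first [exact: psX | exact: psubst_const | idtac].
by rewrite pmap_coef_const ?psubst_const //; apply: free_d_linear.
Qed.

End GelfandDorfmanBracket.

(** * Normalization of linear combinations by reflection *)

(** Signs are recorded by their two parities and not as scalars, so that for concrete parities all
    coefficients are integers, computed without reference to [K]. *)
Inductive zexpr (I : Type) :=
  | ZVar of I
  | ZZero
  | ZAdd of zexpr I & zexpr I
  | ZOpp of zexpr I
  | ZSign of bool & bool & zexpr I.
Arguments ZZero {I}.

Section Normalization.
Context {K : fieldType} {V : lmodType K} {I : eqType}.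
Implicit Types (t : zexpr I) (env : I -> V).

Fixpoint zeval env t : V :=
  match t with
  | ZVar i => env i
  | ZZero => 0
  | ZAdd t1 t2 => zeval env t1 + zeval env t2
  | ZOpp t => - zeval env t
  | ZSign i j t => ssign i j *: zeval env t
  end.

Fixpoint zcoef t (i : I) : int :=
  match t with
  | ZVar i' => (i' == i)%:Z
  | ZZero => 0
  | ZAdd t1 t2 => zcoef t1 i + zcoef t2 i
  | ZOpp t => - zcoef t i
  | ZSign b b' t => if b && b' then - zcoef t i else zcoef t i
  end.

Fixpoint zvars t : seq I :=
  match t with
  | ZVar i => [:: i]
  | ZZero => [::]
  | ZAdd t1 t2 => zvars t1 ++ zvars t2
  | ZOpp t | ZSign _ _ t => zvars t
  end.

(** The list [s] is left free so that both sides of an equation expand over one common list of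
    atoms. *)
Lemma zeval_coef env (s : seq I) t : uniq s -> {subset zvars t <= s} ->
  zeval env t = \sum_(i <- s) env i *~ zcoef t i.
Proof.
move=> us; elim: t => [m||t1 IH1 t2 IH2|t IH|b b' t IH] /= sub.
- rewrite (bigD1_seq m) ?sub ?mem_head //= eqxx big1 ?addr0 // => n ne.
  by rewrite eq_sym (negPf ne).
- by rewrite big1.
- rewrite IH1 => [|i it]; last by rewrite sub // mem_cat it.
  rewrite IH2 => [|i it]; last by rewrite sub // mem_cat it orbT.
  by rewrite -big_split; apply: eq_bigr => n _; rewrite mulrzDr.
- by rewrite IH // -sumrN; apply: eq_bigr => n _; rewrite mulrNz.
- rewrite IH // /ssign; case: (b && b'); last by rewrite scale1r.
  by rewrite scaleN1r -sumrN; apply: eq_bigr => n _; rewrite mulrNz.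
Qed.

Definition zequiv t1 t2 :=
  all (fun i => zcoef t1 i == zcoef t2 i) (undup (zvars t1 ++ zvars t2)).

Lemma zeval_eq env t1 t2 : zequiv t1 t2 -> zeval env t1 = zeval env t2.
Proof.
move/allP=> h; have us := undup_uniq (zvars t1 ++ zvars t2).
rewrite !(zeval_coef _ us); first by apply: eq_big_seq => i /h /eqP->.
- by move=> i it; rewrite mem_undup mem_cat it orbT.
- by move=> i it; rewrite mem_undup mem_cat it.
Qed.

End Normalization.

Inductive oexpr :=
  | OE of zexpr nat
  | OAdd of oexpr & oexpr
  | OOpp of oexpr
  | OSign of bool & bool & oexpr
  | OL of oexpr
  | OM of oexpr
  | OD of oexpr.

Lemma iter_commute (T : Type) (f g : T -> T) n x :
  (forall x, f (g x) = g (f x)) -> iter n f (g x) = g (iter n f x).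
Proof. by move=> fg; elim: n => [//|n IHn]; rewrite !iterS IHn fg. Qed.

Section OperatorNormalization.
Context {K : fieldType} {A W : lmodType K}.
Variables (L M D : W -> W) (E : A -> W) (e : seq A).
Hypotheses (LL : linear L) (ML : linear M) (DL : linear D) (EL : linear E).
Hypotheses (LM : forall x, L (M x) = M (L x))
  (DLC : forall x, D (L x) = L (D x)) (DM : forall x, D (M x) = M (D x)).

Fixpoint oeval (t : oexpr) : W :=
  match t with
  | OE t => E (zeval (nth 0 e) t)
  | OAdd t1 t2 => oeval t1 + oeval t2
  | OOpp t => - oeval t
  | OSign i j t => ssign i j *: oeval t
  | OL t => L (oeval t)
  | OM t => M (oeval t)
  | OD t => D (oeval t)
  end.

Definition oword : Type := nat * nat * nat * nat.

Fixpoint zword (p q r : nat) (t : zexpr nat) : zexpr oword :=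
  match t with
  | ZVar n => ZVar (p, q, r, n)
  | ZZero => ZZero
  | ZAdd t1 t2 => ZAdd (zword p q r t1) (zword p q r t2)
  | ZOpp t => ZOpp (zword p q r t)
  | ZSign i j t => ZSign i j (zword p q r t)
  end.

(** The counters record how many [L], [M] and [D] lie above the current subterm. Commutation makes
    their order irrelevant, so a word and an atom together become one new atom. *)
Fixpoint onorm (p q r : nat) (t : oexpr) : zexpr oword :=
  match t with
  | OE t => zword p q r t
  | OAdd t1 t2 => ZAdd (onorm p q r t1) (onorm p q r t2)
  | OOpp t => ZOpp (onorm p q r t)
  | OSign i j t => ZSign i j (onorm p q r t)
  | OL t => onorm p.+1 q r t
  | OM t => onorm p q.+1 r t
  | OD t => onorm p q r.+1 t
  end.

Definition apply_word p q r (x : W) : W := iter p L (iter q M (iter r D x)).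
Definition oword_value (w : oword) : W :=
  let: (p, q, r, n) := w in apply_word p q r (E e`_n).

Let apply_word_linear p q r : linear (apply_word p q r).
Proof.
have iterL n (f : W -> W) (fL : linear f) := linear_iter fL n.
by move=> c x y; rewrite /apply_word !iterL.
Qed.

Lemma zwordE p q r t :
  zeval oword_value (zword p q r t) = apply_word p q r (E (zeval (nth 0 e) t)).
Proof.
have wL := apply_word_linear p q r.
elim: t => [//||t1 IH1 t2 IH2|t IH|b b' t IH] /=.
- by rewrite (lin0 EL) (lin0 wL).
- by rewrite IH1 IH2 (linD EL) (linD wL).
- by rewrite IH (linN EL) (linN wL).
- by rewrite IH (linZ EL) (linZ wL).
Qed.

Lemma onormE p q r t :
  zeval oword_value (onorm p q r t) = apply_word p q r (oeval t).
Proof.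
elim: t p q r => [t|t1 IH1 t2 IH2|t IH|b b' t IH|t IH|t IH|t IH] p q r /=.
- exact: zwordE.
- by rewrite IH1 IH2 (linD (apply_word_linear p q r)).
- by rewrite IH (linN (apply_word_linear p q r)).
- by rewrite IH (linZ (apply_word_linear p q r)).
- rewrite IH /apply_word iterS (iter_commute r _ DLC).
  by rewrite (@iter_commute _ M L q) // (@iter_commute _ L L p).
- by rewrite IH /apply_word iterS (iter_commute r _ DM) (@iter_commute _ M M q).
- by rewrite IH /apply_word iterS (@iter_commute _ D D r).
Qed.

Lemma oeval_eq t1 t2 : zequiv (onorm 0 0 0 t1) (onorm 0 0 0 t2) ->
  oeval t1 = oeval t2.
Proof. by move/(zeval_eq oword_value); rewrite !onormE. Qed.

End OperatorNormalization.

Ltac zindex x e :=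
  lazymatch e with
  | x :: _ => constr:(0%N)
  | _ :: ?e' => let n := zindex x e' in constr:(S n)
  end.

Ltac zatoms t e :=
  lazymatch t with
  | GRing.add ?a ?b => let e' := zatoms a e in zatoms b e'
  | GRing.opp ?a => zatoms a e
  | GRing.zero => e
  | GRing.scale (ssign _ _) ?a => zatoms a e
  | _ => match e with
         | _ => let n := zindex t e in e
         | _ => constr:(t :: e)
         end
  end.

Ltac zreify t e :=
  lazymatch t with
  | GRing.add ?a ?b =>
      let a' := zreify a e in let b' := zreify b e in constr:(ZAdd a' b')
  | GRing.opp ?a => let a' := zreify a e in constr:(ZOpp a')
  | GRing.zero => constr:(@ZZero nat)
  | GRing.scale (ssign ?i ?j) ?a =>
      let a' := zreify a e in constr:(ZSign i j a')
  | _ => let n := zindex t e in constr:(ZVar n)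
  end.

Ltac oatoms E t e :=
  lazymatch t with
  | GRing.add ?a ?b => let e' := oatoms E a e in oatoms E b e'
  | GRing.opp ?a => oatoms E a e
  | GRing.scale (ssign _ _) ?a => oatoms E a e
  | E ?a => zatoms a e
  | ?T ?a => oatoms E a e
  end.

Ltac oreify L M D E t e :=
  let rec go t :=
    lazymatch t with
    | GRing.add ?a ?b => let a' := go a in let b' := go b in constr:(OAdd a' b')
    | GRing.opp ?a => let a' := go a in constr:(OOpp a')
    | GRing.scale (ssign ?i ?j) ?a => let a' := go a in constr:(OSign i j a')
    | E ?a => let a' := zreify a e in constr:(OE a')
    | L ?a => let a' := go a in constr:(OL a')
    | M ?a => let a' := go a in constr:(OM a')
    | D ?a => let a' := go a in constr:(OD a')
    end in
  go t.

Ltac parity_cases :=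
  repeat match goal with b : bool |- _ => clear b || destruct b end;
  vm_compute; reflexivity.

(* Closes equalities between linear combinations, with coefficients that are
   products of signs [ssign i j], of arbitrary vectors. *)
Ltac zmod :=
  lazymatch goal with
  | |- @eq ?V ?l ?r =>
      let e := zatoms l (@nil V) in
      let e := zatoms r e in
      let l' := zreify l e in
      let r' := zreify r e in
      apply: (@zeval_eq _ _ _ (nth 0 e) l' r'); parity_cases
  end.

(* The same for vectors of the form [P (E x)] where [P] is a word in three
   commuting linear operators and [E] is linear. *)
Ltac omod A L M D E LL ML DL EL LM DL' DM :=
  lazymatch goal with
  | |- @eq ?V ?l ?r =>
      let e := oatoms E l (@nil A) in
      let e := oatoms E r e in
      let l' := oreify L M D E l e in
      let r' := oreify L M D E r e in
      apply: (@oeval_eq _ _ _ L M D E e LL ML DL EL LM DL' DM l' r');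
      parity_cases
  end.

(** * The Jacobi defect *)

(* [jacX a b c] is the coefficient of the monomial X in the Jacobi defect of
   a, b, c in A, the letters D, L, M standing for d, lambda, mu. *)
Section JacobiCoefficients.
Context {K : fieldType} {A : superspace K}.
Variables (lie nov : {bilinear A -> A -> A}) (al : A -> A) (i j k : bool).
Local Notation "[ x , y ]" := (lie x y).
Local Notation "x \circ y" := (nov x y) (at level 40, left associativity).
Local Notation s := (ssign i j : K).
Local Notation t := (ssign i k : K).
Local Notation r := (ssign j k : K).

Definition jac1 a b c : A :=
  [[c, b], al a] - [al c, [b, a]] - s *: [[c, a], al b].

Definition jacD a b c : A :=
  [c \circ b, al a] - s *: [c \circ a, al b] + [c, b] \circ al a
  - s *: ([c, a] \circ al b) - al c \circ [b, a].

Definition jacL a b c : A :=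
  [c, b] \circ al a + s *: (t *: (al a \circ [c, b])) + [c \circ b, al a]
  - al c \circ [b, a] - r *: (t *: ([b, a] \circ al c))
  - s *: [al c, a \circ b] - s *: [c \circ a, al b]
  - s *: (t *: [a \circ c, al b]).

Definition jacM a b c : A :=
  [c \circ b, al a] + r *: [b \circ c, al a] - al c \circ [b, a]
  - r *: (t *: ([b, a] \circ al c)) + [al c, b \circ a]
  - s *: ([c, a] \circ al b) - r *: (al b \circ [c, a])
  - s *: [c \circ a, al b].

Definition jacDD a b c : A :=
  (c \circ b) \circ al a - s *: ((c \circ a) \circ al b).

Definition jacDL a b c : A :=
  (c \circ b) \circ al a + (c \circ b) \circ al a
  + s *: (t *: (al a \circ (c \circ b))) - s *: (al c \circ (a \circ b))
  - s *: ((c \circ a) \circ al b) - s *: (t *: ((a \circ c) \circ al b)).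

Definition jacDM a b c : A :=
  (c \circ b) \circ al a + r *: ((b \circ c) \circ al a)
  + al c \circ (b \circ a) - s *: ((c \circ a) \circ al b)
  - s *: ((c \circ a) \circ al b) - r *: (al b \circ (c \circ a)).

Definition jacLL a b c : A :=
  (c \circ b) \circ al a + s *: (t *: (al a \circ (c \circ b)))
  - s *: (al c \circ (a \circ b))
  - s *: (r *: (t *: ((a \circ b) \circ al c))).

Definition jacMM a b c : A :=
  al c \circ (b \circ a) + r *: (t *: ((b \circ a) \circ al c))
  - s *: ((c \circ a) \circ al b) - r *: (al b \circ (c \circ a)).

Definition jacLM a b c : A :=
  jacLL a b c + jacMM a b c + r *: ((b \circ c) \circ al a)
  + r *: (s *: (t *: (al a \circ (b \circ c))))
  - s *: (t *: ((a \circ c) \circ al b)) - t *: (r *: (al b \circ (a \circ c))).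

End JacobiCoefficients.

Section JacobiExpansion.
Context {K : fieldType} {A : superspace K}.
Variables (lie nov : {bilinear A -> A -> A}) (al : {linear A -> A}).
Hypotheses (lie_even : even_op lie) (nov_even : even_op nov).
Hypothesis al_even : even_map al.

Local Notation free := (free_module A).
Local Notation br := (gd_bracket lie nov).

Context {W : lmodType K}.
Variables (L M D : W -> W) (c : free -> W).
Hypotheses (LL : linear L) (ML : linear M) (DL : linear D) (cL : linear c).
Hypotheses (LM : forall x, L (M x) = M (L x))
  (DLC : forall x, D (L x) = L (D x)) (DM : forall x, D (M x) = M (D x))
  (cd : forall x, c (free_d A x) = D (c x)).

(** With a free scalar in place of the sign, the defect is linear in each argument on all of K[d]A,
    whatever the parities. *)
Definition jacobiator (s : K) x y z : W :=
  nested_right br M L c (free_ext al x) y z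
  - nested_left br L (fun P => L P + M P) c x y (free_ext al z)
  - s *: nested_right br L M c (free_ext al y) x z.

Let E (u : A) : W := c (pconst u).
Let EL : linear E. Proof. exact: (linear_comp_fun cL (@pconst_linear K A)). Qed.

Let brB := gd_bracket_bilinear lie nov.
Let brdl := gd_bracket_dl lie nov.
Let brdr := gd_bracket_dr lie nov.

Section Operator.
Variable T : W -> W.
Hypotheses (TL : linear T) (DT : forall x, D (T x) = T (D x)).

Definition gd_value (s : K) (a b : A) : W :=
  E (lie b a) + (D (E (nov b a)) + T (E (nov b a))) + s *: T (E (nov a b)).

Lemma psubst_br_const i j a b : homog i a -> homog j b ->
  psubst T c (br (pconst a) (pconst b)) = gd_value (ssign i j) a b.
Proof.
move=> ha hb; rewrite gd_bracket_const (gd_bracket_genE _ _ ha hb).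
by rewrite psubst_gd_bracket // cd.
Qed.

Variable S : W -> W.
Hypothesis SL : linear S.

(** The outer signs come from the parity k + j of the inner products. The summand d(z o y) of the
    inner bracket sits in the right slot, where d becomes [D + T]. *)
Lemma nested_right_const i j k x y z : homog i x -> homog j y -> homog k z ->
  nested_right br S T c (pconst x) (pconst y) (pconst z) =
    gd_value (ssign i (k (+) j)) x (lie z y) +
    (D (gd_value (ssign i (k (+) j)) x (nov z y)) +
     T (gd_value (ssign i (k (+) j)) x (nov z y)) +
     S (gd_value (ssign i (k (+) j)) x (nov z y))) +
    ssign j k *: S (gd_value (ssign i (j (+) k)) x (nov y z)).
Proof.
move=> hx hy hz; rewrite /nested_right gd_bracket_const.
rewrite (gd_bracket_genE _ _ hy hz) psubst_gd_bracket //; last first.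
  move=> e u v; rewrite brB.2.
  exact: (psubst_linear TL cL).
have e := psubst_br_const hx (nov_even hz hy).
congr (_ + (_ + S _) + _ *: S _).
- exact: psubst_br_const (lie_even hz hy).
- by rewrite /= (psubst_dr free_d_linear brdr TL DL cL DT cd) e.
- exact: e.
- exact: psubst_br_const (nov_even hy hz).
Qed.

(** Here d(y o x) sits in the left slot of the outer bracket, so d becomes [- T]. *)
Lemma nested_left_const i j k x y z : homog i x -> homog j y -> homog k z ->
  nested_left br S T c (pconst x) (pconst y) (pconst z) =
    gd_value (ssign (j (+) i) k) (lie y x) z +
    (- T (gd_value (ssign (j (+) i) k) (nov y x) z) +
     S (gd_value (ssign (j (+) i) k) (nov y x) z)) +
    ssign i j *: S (gd_value (ssign (i (+) j) k) (nov x y) z).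
Proof.
move=> hx hy hz; rewrite /nested_left gd_bracket_const.
rewrite (gd_bracket_genE _ _ hx hy) psubst_gd_bracket //; last first.
  move=> e u v; rewrite (brB.1 (pconst z)).
  exact: (psubst_linear TL cL).
have e := psubst_br_const (nov_even hy hx) hz.
congr (_ + (_ + S _) + _ *: S _).
- exact: psubst_br_const (lie_even hy hx) _.
- by rewrite /= (psubst_dl brdl TL cL) e.
- exact: e.
- exact: psubst_br_const (nov_even hx hy) _.
Qed.

End Operator.

Lemma jacobiator_const i j k a b z : homog i a -> homog j b -> homog k z ->
  jacobiator (ssign i j) (pconst a) (pconst b) (pconst z) =
    E (jac1 lie al i j a b z) + D (E (jacD lie nov al i j a b z))
    + L (E (jacL lie nov al i j k a b z)) + M (E (jacM lie nov al i j k a b z))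
    + D (D (E (jacDD nov al i j a b z))) + L (D (E (jacDL nov al i j k a b z)))
    + M (D (E (jacDM nov al i j k a b z)))
    + L (L (E (jacLL nov al i j k a b z)))
    + M (L (E (jacLM nov al i j k a b z)))
    + M (M (E (jacMM nov al i j k a b z))).
Proof.
move=> ha hb hz; have [[hla hlb] hlz] := (al_even ha, al_even hb, al_even hz).
have LML : linear (fun P => L P + M P) by apply: linear_add_fun.
rewrite /jacobiator /free_ext !pmap_coef_const; try exact: linearP.
rewrite (nested_right_const LL DLC ML hla hb hz).
rewrite (nested_right_const ML DM LL hlb ha hz).
rewrite (nested_left_const LML LL ha hb hlz).
rewrite /gd_value /jacLM /jac1 /jacD /jacL /jacM /jacDD /jacDL /jacDM /jacLL
  /jacMM.
omod A L M D E LL ML DL EL LM DLC DM.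
Qed.

Let extL : linear (free_ext al).
Proof. exact: (pmap_coef_linear (linearP al)). Qed.

Let ext_d x : free_ext al (free_d A x) = free_d A (free_ext al x).
Proof. exact: (pmap_coef_mulX x (linearP al)). Qed.

Let LML : linear (fun P => L P + M P). Proof. exact: linear_add_fun. Qed.
Let LLM P : L (L P + M P) = L (L P) + M (L P).
Proof. by rewrite (linD LL) LM. Qed.
Let DLM P : D (L P + M P) = L (D P) + M (D P).
Proof. by rewrite (linD DL) DLC DM. Qed.

Let dL := @free_d_linear K A.

Let ML' P : M (L P) = L (M P). Proof. by rewrite LM. Qed.

Lemma jacobiator_linear1 s y z : linear (fun x => jacobiator s x y z).
Proof.
exact: (linear_add_fun (linear_add_fun
  (linear_comp_fun (nested_right_linear1 brB ML LL cL y z) extL)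
  (linear_opp_fun (nested_left_linear1 brB LL LML cL y (free_ext al z))))
  (linear_opp_fun (linear_scale_fun
    (nested_right_linear2 brB LL ML cL (free_ext al y) z) s))).
Qed.

Lemma jacobiator_linear2 s x z : linear (fun y => jacobiator s x y z).
Proof.
exact: (linear_add_fun (linear_add_fun
  (nested_right_linear2 brB ML LL cL (free_ext al x) z)
  (linear_opp_fun (nested_left_linear2 brB LL LML cL x (free_ext al z))))
  (linear_opp_fun (linear_scale_fun
    (linear_comp_fun (nested_right_linear1 brB LL ML cL x z) extL) s))).
Qed.

Lemma jacobiator_linear3 s x y : linear (fun z => jacobiator s x y z).
Proof.
exact: (linear_add_fun (linear_add_fun
  (nested_right_linear3 brB ML LL cL (free_ext al x) y)
  (linear_opp_fun
    (linear_comp_fun (nested_left_linear3 brB LL LML cL x y) extL)))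
  (linear_opp_fun (linear_scale_fun
    (nested_right_linear3 brB LL ML cL (free_ext al y) x) s))).
Qed.

Lemma jacobiator_d1 s x y z :
  jacobiator s (free_d A x) y z = - L (jacobiator s x y z).
Proof.
rewrite /jacobiator ext_d (nested_right_d1 brdl ML LL cL ML').
rewrite (nested_left_d1 brB brdl LL LML cL).
rewrite (nested_right_d2 brB brdl LL ML cL).
by rewrite !(linD LL) !(linN LL) (linZ LL) scalerN !opprD.
Qed.

(** The left-nested term yields [L - (L + M)], which agrees with the [- M] of the other two
    terms. *)
Lemma jacobiator_d2 s x y z :
  jacobiator s x (free_d A y) z = - M (jacobiator s x y z).
Proof.
rewrite /jacobiator ext_d (nested_right_d2 brB brdl ML LL cL).
rewrite (nested_left_d2 dL brB brdl brdr LL LML cL LLM).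
rewrite (nested_right_d1 brdl LL ML cL LM).
rewrite !(linD ML) !(linN ML) (linZ ML) scalerN /=.
zmod.
Qed.

Lemma jacobiator_d3 s x y z : jacobiator s x y (free_d A z) =
  D (jacobiator s x y z) + L (jacobiator s x y z) + M (jacobiator s x y z).
Proof.
rewrite /jacobiator ext_d.
rewrite (nested_right_d3 dL brB brdr ML LL DL cL ML' DM DLC cd).
rewrite (nested_left_d3 dL brdr LL LML DL cL LLM DLC DLM cd).
rewrite (nested_right_d3 dL brB brdr LL ML DL cL LM DLC DM cd).
have scaleZ (f : W -> W) u : linear f -> f (s *: u) = s *: f u.
  by move=> fL; rewrite (linZ fL).
have scaleD (u v w : W) : s *: (u + v + w) = s *: u + s *: v + s *: w.
  by rewrite !scalerDr.
rewrite !(linD LL) !(linN LL) (scaleZ L) // !(linD ML) !(linN ML) (scaleZ M) //.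
rewrite !(linD DL) !(linN DL) (scaleZ D) // scaleD /=.
zmod.
Qed.

Lemma free_linear_eq0 (f : free -> W) i : linear f ->
  (forall x, f x = 0 -> f (free_d A x) = 0) ->
  (forall u, homog i u -> f (pconst u) = 0) -> forall x, fhomog i x -> f x = 0.
Proof.
move=> fL fd fc; apply: polyv_ind_in => // [|p q p0 q0]; first exact: lin0 fL.
by rewrite (linD fL) p0 q0 addr0.
Qed.

(** Since d is even, parities do not change along the induction, so one scalar [s] serves from the
    generators to all of K[d]A. *)
Lemma jacobiator_eq0 s i j k :
    (forall u v w, homog i u -> homog j v -> homog k w ->
      jacobiator s (pconst u) (pconst v) (pconst w) = 0) ->
  forall x y z, fhomog i x -> fhomog j y -> fhomog k z ->
  jacobiator s x y z = 0.
Proof.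
move=> h x y z hx hy hz; move: x hx.
apply: free_linear_eq0 => [|x e|u hu]; first exact: jacobiator_linear1.
  by rewrite jacobiator_d1 e (lin0 LL) oppr0.
move: y hy; apply: free_linear_eq0 => [|y e|v hv].
- exact: jacobiator_linear2.
- by rewrite jacobiator_d2 e (lin0 ML) oppr0.
move: z hz; apply: free_linear_eq0 => [|z e|w hw]; last exact: h.
- exact: jacobiator_linear3.
- by rewrite jacobiator_d3 e (lin0 LL) (lin0 ML) (lin0 DL) !addr0.
Qed.

End JacobiExpansion.

(** * Jacobi coefficients and the axioms of the bialgebra *)

Section JacobiVanishing.
Context {K : fieldType} {A : superspace K}.
Variables (lie nov : {bilinear A -> A -> A}) (al : {linear A -> A}).
Hypotheses (lie_even : even_op lie) (nov_even : even_op nov).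
Hypothesis al_even : even_map al.
Local Notation "[ x , y ]" := (lie x y).
Local Notation "x \circ y" := (nov x y) (at level 40, left associativity).

Lemma lie_skew0 i j x y : hom_lie_superalgebra lie al ->
  homog i x -> homog j y -> [x, y] + ssign i j *: [y, x] = 0.
Proof. by move=> h hx hy; rewrite (hl_skew h hx hy) addNr. Qed.

Section Generators.
Variables (i j k : bool) (a b c : A).
Hypotheses (ha : homog i a) (hb : homog j b) (hc : homog k c).
Local Notation s := (ssign i j : K).
Local Notation t := (ssign i k : K).
Local Notation r := (ssign j k : K).

Let left_sym x y z (s' : K) := (x \circ y) \circ al z - al x \circ (y \circ z)
  - s' *: ((y \circ x) \circ al z - al y \circ (x \circ z)).
Let right_comm x y z (s' : K) :=
  (x \circ y) \circ al z - s' *: ((x \circ z) \circ al y).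
Let compat x y z (s' : K) :=
  [x \circ y, al z] - s' *: [x \circ z, al y]
  + [x, y] \circ al z - s' *: ([x, z] \circ al y) - al x \circ [y, z].

Hypothesis GD : super_hom_gelfand_dorfman_bialgebra lie nov al.
Let HL := hgd_lie GD.
Let HN := hgd_novikov GD.

Let LS1 : left_sym c a b (ssign k i) = 0.
Proof. by apply/eqP; rewrite subr_eq0 (hn_left_symmetric HN hc ha hb). Qed.
Let LS2 : left_sym c b a (ssign k j) = 0.
Proof. by apply/eqP; rewrite subr_eq0 (hn_left_symmetric HN hc hb ha). Qed.
Let LS3 : left_sym b a c (ssign j i) = 0.
Proof. by apply/eqP; rewrite subr_eq0 (hn_left_symmetric HN hb ha hc). Qed.
Let RC1 : right_comm c b a (ssign j i) = 0.
Proof. by apply/eqP; rewrite subr_eq0 (hn_right_commutative HN hc hb ha). Qed.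
Let RC2 : right_comm a c b (ssign k j) = 0.
Proof. by apply/eqP; rewrite subr_eq0 (hn_right_commutative HN ha hc hb). Qed.
Let RC3 : right_comm b c a (ssign k i) = 0.
Proof. by apply/eqP; rewrite subr_eq0 (hn_right_commutative HN hb hc ha). Qed.
Let C1 : compat c b a (ssign j i) = 0 := hgd_compat GD hc hb ha.
Let C2 : compat a c b (ssign k j) = 0 := hgd_compat GD ha hc hb.
Let C3 : compat b c a (ssign k i) = 0 := hgd_compat GD hb hc ha.

Let nov_skew i' j' x y z : homog i' x -> homog j' y ->
  [x, y] \circ z + ssign i' j' *: ([y, x] \circ z) = 0.
Proof.
move=> hx hy; rewrite -linearZl_LR -linearDl lie_skew0 //; exact: linear0l.
Qed.

Let lie_skewl i' j' x y z : homog i' x -> homog j' y ->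
  [[x, y], z] + ssign i' j' *: [[y, x], z] = 0.
Proof.
move=> hx hy; rewrite -linearZl_LR -linearDl lie_skew0 //; exact: linear0l.
Qed.

Lemma jacDD_eq0 : jacDD nov al i j a b c = 0.
Proof. by rewrite -[RHS]RC1 /jacDD /right_comm; zmod. Qed.

Lemma jacLL_eq0 : jacLL nov al i j k a b c = 0.
Proof.
(* Products of the form [al x \circ (y \circ z)] occur only in left symmetry and fix its multiplier;
   what remains is right commutativity. The combinations for the other quadratic monomials arise in
   the same way. *)
transitivity (right_comm c b a (ssign j i) + s *: left_sym c a b (ssign k i)
  + s *: (t *: right_comm a c b (ssign k j))).
  by rewrite /jacLL /right_comm /left_sym; zmod.
by rewrite RC1 LS1 RC2 !scaler0 !addr0.
Qed.
Lemma jacDL_eq0 : jacDL nov al i j k a b c = 0.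
Proof.
transitivity (right_comm c b a (ssign j i) + right_comm c b a (ssign j i)
  + s *: left_sym c a b (ssign k i)).
  by rewrite /jacDL /right_comm /left_sym; zmod.
by rewrite RC1 LS1 !scaler0 !addr0.
Qed.

Lemma jacDM_eq0 : jacDM nov al i j k a b c = 0.
Proof.
transitivity (right_comm c b a (ssign j i) + right_comm c b a (ssign j i)
  - left_sym c b a (ssign k j)).
  by rewrite /jacDM /right_comm /left_sym; zmod.
by rewrite RC1 LS2 subr0 addr0.
Qed.

Lemma jacMM_eq0 : jacMM nov al i j k a b c = 0.
Proof.
transitivity (right_comm c b a (ssign j i) - left_sym c b a (ssign k j)
  - r *: right_comm b c a (ssign k i)).
  by rewrite /jacMM /right_comm /left_sym; zmod.
by rewrite RC1 LS2 RC3 scaler0 !subr0.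
Qed.

(** Two of the summands are [jacLL] and [jacMM], already known to vanish; only the other four terms
    call for a combination of axioms. *)
Lemma jacLM_eq0 : jacLM nov al i j k a b c = 0.
Proof.
transitivity (r *: right_comm b c a (ssign k i)
  - s *: (t *: right_comm a c b (ssign k j))
  + r *: (t *: left_sym b a c (ssign j i))).
  rewrite /jacLM jacLL_eq0 jacMM_eq0 /right_comm /left_sym.
  rewrite !scalerDr !scalerN; zmod.
by rewrite RC2 RC3 LS3 !scaler0 subr0 addr0.
Qed.

Lemma jacD_eq0 : jacD lie nov al i j a b c = 0.
Proof. by rewrite -[RHS]C1 /jacD /compat; zmod. Qed.

Lemma jacL_eq0 : jacL lie nov al i j k a b c = 0.
Proof.
(* The terms [[c \circ b, al a]] and [[a \circ c, al b]] fix the multipliers of the two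
   compatibility conditions. The last three summands repair brackets that appear in the opposite
   order. *)
transitivity (compat c b a (ssign j i) - s *: (t *: compat a c b (ssign k j))
  + s *: ([c, a] \circ al b + ssign k i *: ([a, c] \circ al b))
  - r *: (t *: ([b, a] \circ al c + ssign j i *: ([a, b] \circ al c)))
  - s *: ([al c, a \circ b] + ssign k (i (+) j) *: [a \circ b, al c])).
  by rewrite /jacL /compat; zmod.
rewrite C1 C2 (nov_skew _ hc ha) (nov_skew _ hb ha).
rewrite (lie_skew0 HL (al_even hc) (nov_even ha hb)).
by rewrite !scaler0 !subr0 addr0.
Qed.

Lemma jacM_eq0 : jacM lie nov al i j k a b c = 0.
Proof.
transitivity (compat c b a (ssign j i) + r *: compat b c a (ssign k i)
  + ([al c, b \circ a] + ssign k (j (+) i) *: [b \circ a, al c])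
  - ([c, b] \circ al a + ssign k j *: ([b, c] \circ al a))).
  by rewrite /jacM /compat; zmod.
rewrite C1 C3 (nov_skew _ hc hb).
rewrite (lie_skew0 HL (al_even hc) (nov_even hb ha)).
by rewrite !scaler0 subr0 !addr0.
Qed.

Lemma jac1_eq0 : jac1 lie al i j a b c = 0.
Proof.
(* The coefficient has the Leibniz form and the axiom the cyclic form; two uses of skew-symmetry
   pass between them. The factor [t] cancels the sign of the first cyclic term. *)
transitivity (t *: (ssign k i *: [[c, b], al a] + ssign k j *: [[b, a], al c]
    + ssign j i *: [[a, c], al b])
  - ([al c, [b, a]] + ssign k (j (+) i) *: [[b, a], al c])
  - s *: ([[c, a], al b] + ssign k i *: [[a, c], al b])).
  by rewrite /jac1; zmod.
rewrite (hl_jacobi HL hc hb ha) (lie_skewl _ hc ha).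
rewrite (lie_skew0 HL (al_even hc) (lie_even hb ha)).
by rewrite !scaler0 !subr0.
Qed.

End Generators.

(** The lambda-bracket reverses its arguments, so most axioms at (x, y, z) are read off at (z, y,
    x). Left symmetry is read off at (y, z, x), and needs right commutativity first. *)
Lemma gelfand_dorfman_of_jac :
    (forall i j x y, homog i x -> homog j y -> [x, y] = - (ssign i j *: [y, x]))
    -> (forall i j k a b c, homog i a -> homog j b -> homog k c ->
      [/\ jac1 lie al i j a b c = 0, jacD lie nov al i j a b c = 0,
          jacDD nov al i j a b c = 0 & jacLL nov al i j k a b c = 0]) ->
  super_hom_gelfand_dorfman_bialgebra lie nov al.
Proof.
move=> skew jac.
have lieB : bilinear_for *:%R *:%R lie.
  by split=> u e x y; [apply: linearPl | apply: linearPr].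
have novB : bilinear_for *:%R *:%R nov.
  by split=> u e x y; [apply: linearPl | apply: linearPr].
have alL : linear al by apply: linearP.
have RC i j k x y z : homog i x -> homog j y -> homog k z ->
    (x \circ y) \circ al z - ssign j k *: ((x \circ z) \circ al y) = 0.
  move=> hx hy hz; have [_ _ <- _] := jac _ _ _ _ _ _ hz hy hx.
  by rewrite /jacDD; zmod.
split; first split=> //.
- move=> i j k x y z hx hy hz; have [e _ _ _] := jac _ _ _ _ _ _ hz hy hx.
  transitivity (ssign i k *: jac1 lie al k j z y x
    + ssign i k *: ([al x, [y, z]] + ssign i (j (+) k) *: [[y, z], al x])
    + ssign i k *: (ssign j k *:
      ([[x, z], al y] + ssign i k *: [[z, x], al y]))).
    by rewrite /jac1; zmod.
  rewrite e (skew _ _ _ _ (al_even hx) (lie_even hy hz)) addNr.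
  by rewrite (skew _ _ _ _ hx hz) linearNl linearZl_LR addNr !scaler0 !addr0.
- split=> // i j k x y z hx hy hz.
    apply/eqP; rewrite -subr_eq0; apply/eqP.
    have [_ _ e e'] := jac _ _ _ _ _ _ hy hz hx.
    (* [jacLL] is a signed instance of left symmetry plus two instances of right commutativity. The
       latter are subtracted, and the outer sign, whose square is 1, clears the remaining one. *)
    transitivity (ssign j k *: (jacLL nov al j k i y z x
      - jacDD nov al j k y z x
      - ssign j k *: (ssign j i *: ((y \circ x) \circ al z
        - ssign i k *: ((y \circ z) \circ al x))))).
      by rewrite /jacLL /jacDD; zmod.
    by rewrite e e' (RC _ _ _ _ _ _ hy hx hz) !scaler0 !subr0 scaler0.
  by apply/eqP; rewrite -subr_eq0 (RC _ _ _ _ _ _ hx hy hz).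
- move=> i j k x y z hx hy hz; have [_ <- _ _] := jac _ _ _ _ _ _ hz hy hx.
  by rewrite /jacD; zmod.
Qed.

End JacobiVanishing.

(** * Skew-symmetry *)

Section SkewDefect.
Context {K : fieldType} {R : lmodType K}.
Variables (d : R -> R) (br : R -> R -> polyv R).
Hypotheses (dL : linear d) (brB : bilinear_for *:%R *:%R br).
Hypothesis brdl : forall x y, br (d x) y = - pmulX (br x y).
Hypothesis brdr : forall x y,
  br x (d y) = pmap_coef d (br x y) + pmulX (br x y).
Local Notation lam := (@pmulX K R).
Local Notation dd := (@pmap_coef K R R d).

Definition skew_defect (s : K) (x y : R) : polyv R :=
  br x y + s *: psubst (fun P => - lam P - dd P) (@pconst K R) (br y x).

Let lamL : linear lam. Proof. exact: pmulX_linear. Qed.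
Let ddL : linear dd. Proof. exact: pmap_coef_linear dL. Qed.
Let NL : linear (fun P => - lam P - dd P).
Proof. exact: (linear_add_fun (linear_opp_fun lamL) (linear_opp_fun ddL)). Qed.
Let pcL : linear (@pconst K R). Proof. exact: pconst_linear. Qed.
Let dd_lam P : dd (lam P) = lam (dd P). Proof. exact: pmap_coef_mulX. Qed.
Let ddN P : dd (- lam P - dd P) = - lam (dd P) - dd (dd P).
Proof. by rewrite (linD ddL) !(linN ddL) dd_lam. Qed.
Let cd x : pconst (d x) = dd (pconst x).
Proof. by rewrite pmap_coef_const. Qed.

Lemma skew_defect_linear1 s y : linear (fun x => skew_defect s x y).
Proof.
exact: (linear_add_fun (brB.1 y) (linear_scale_fun
  (linear_comp_fun (psubst_linear NL pcL) (brB.2 y)) s)).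
Qed.

Lemma skew_defect_linear2 s x : linear (fun y => skew_defect s x y).
Proof.
exact: (linear_add_fun (brB.2 x) (linear_scale_fun
  (linear_comp_fun (psubst_linear NL pcL) (brB.1 x)) s)).
Qed.

(** The rule [psubst_dr] applies with [T = - lam - dd] and [D = dd], and [D + T] is then [- lam], as
    in the first summand. *)
Lemma skew_defect_d1 s x y : skew_defect s (d x) y = - lam (skew_defect s x y).
Proof.
rewrite /skew_defect brdl (psubst_dr dL brdr NL ddL pcL ddN cd).
set q := psubst _ _ _; rewrite (linD lamL) (linZ lamL) opprD -scalerN.
by congr (_ + _ *: _); rewrite addrC subrK.
Qed.

Lemma skew_defect_d2 s x y :
  skew_defect s x (d y) = dd (skew_defect s x y) + lam (skew_defect s x y).
Proof.
rewrite /skew_defect brdr (psubst_dl brdl NL pcL).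
set q := psubst _ _ _; rewrite (linD lamL) (linZ lamL) (linD ddL) (linZ ddL).
rewrite [RHS]addrACA -scalerDr; congr (_ + _ *: _).
by rewrite opprB opprK.
Qed.

End SkewDefect.

Section SkewSymmetry.
Context {K : fieldType} {A : superspace K}.
Variables lie nov : {bilinear A -> A -> A}.

Local Notation free := (free_module A).
Local Notation br := (gd_bracket lie nov).
Local Notation defect := (skew_defect (free_d A) br).
Local Notation cst := (fun u : A => @pconst K free (pconst u)).

(** After the substitution of -lambda - d all terms in [nov] cancel in pairs, so skew-symmetry
    constrains only [lie]. *)
Lemma skew_combination (W : lmodType K) (L D : W -> W) (E : A -> W) i j u v :
    linear L -> linear D -> linear E -> (forall x, D (L x) = L (D x)) ->
  E (lie v u) + (D (E (nov v u)) + L (E (nov v u)))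
    + ssign i j *: L (E (nov u v))
    + ssign i j *: (E (lie u v)
        + (D (E (nov u v)) + (- L (E (nov u v)) - D (E (nov u v))))
        + ssign j i *: (- L (E (nov v u)) - D (E (nov v u))))
  = E (lie v u + ssign i j *: lie u v).
Proof.
move=> LL DL EL DLC; have LLC x : L (L x) = L (L x) by [].
(* Only one variable occurs, so [L] also fills the place of the second operator. *)
omod A L L D E LL LL DL EL LLC DLC DLC.
Qed.

Let dL := @free_d_linear K A.
Let lamL := @pmulX_linear K free.
Let ddL := pmap_coef_linear dL.

Lemma skew_defect_const i j u v : homog i u -> homog j v ->
  defect (ssign i j) (pconst u) (pconst v)
  = cst (lie v u + ssign i j *: lie u v).
Proof.
move=> hu hv; rewrite /skew_defect !gd_bracket_const.
rewrite (gd_bracket_genE _ _ hu hv) (gd_bracket_genE _ _ hv hu).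
rewrite psubst_gd_bracket; last 2 first.
- exact: (linear_add_fun (linear_opp_fun lamL) (linear_opp_fun ddL)).
- exact: pconst_linear.
have -> x : pconst (free_d A x) = pmap_coef (free_d A) (pconst x).
  by rewrite pmap_coef_const.
apply: (skew_combination i j u v lamL ddL
  (linear_comp_fun (@pconst_linear K free) (@pconst_linear K A))) => x.
exact: pmap_coef_mulX.
Qed.

Lemma skew_defect_eq0 s i j :
    (forall u v, homog i u -> homog j v ->
      defect s (pconst u) (pconst v) = 0) ->
  forall x y, fhomog i x -> fhomog j y -> defect s x y = 0.
Proof.
have brB := gd_bracket_bilinear lie nov.
have brdl := gd_bracket_dl lie nov; have brdr := gd_bracket_dr lie nov.
move=> h x y hx hy; move: x hx.
apply: free_linear_eq0 => [|x e|u hu].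
- exact: skew_defect_linear1.
- by rewrite (skew_defect_d1 dL brdl brdr) e (lin0 lamL) oppr0.
move: y hy; apply: free_linear_eq0 => [|y e|v hv]; last exact: h.
- exact: skew_defect_linear2.
- by rewrite (skew_defect_d2 dL brdl brdr) e (lin0 lamL) (lin0 ddL) addr0.
Qed.

End SkewSymmetry.

(** * Coefficients of polynomials in lambda, mu and d *)

Lemma coefficients_eq0 (K : fieldType) (A W : lmodType K) (L M D : W -> W)
    (E : A -> W) (C : nat -> nat -> nat -> W -> A) :
    (forall p q r, linear (C p q r)) ->
    (forall p q r P, C p q r (L P) = if p is p'.+1 then C p' q r P else 0) ->
    (forall p q r P, C p q r (M P) = if q is q'.+1 then C p q' r P else 0) ->
    (forall p q r P, C p q r (D P) = if r is r'.+1 then C p q r' P else 0) ->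
    (forall p q r x,
      C p q r (E x) = if (p, q, r) is (0, 0, 0)%N then x else 0) ->
  forall x1 xD xL xM xDD xDL xDM xLL xLM xMM : A,
    E x1 + D (E xD) + L (E xL) + M (E xM) + D (D (E xDD)) + L (D (E xDL))
    + M (D (E xDM)) + L (L (E xLL)) + M (L (E xLM)) + M (M (E xMM)) = 0 ->
  [/\ x1 = 0, xD = 0, xDD = 0 & xLL = 0].
Proof.
move=> CL cL cM cD cE x1 xD xL xM xDD xDL xDM xLL xLM xMM e.
(* [C p q r] picks the coefficient of [L^p M^q D^r], so the four triples below select 1, d, d^2 and
   lambda^2. *)
have h p q r := etrans (congr1 (C p q r) e) (lin0 (CL p q r)).
split; [rewrite -[RHS](h 0 0 0)%N | rewrite -[RHS](h 0 0 1)%N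
  | rewrite -[RHS](h 0 0 2)%N | rewrite -[RHS](h 2 0 0)%N];
  by rewrite !(linD (CL _ _ _)) !(cL, cM, cD, cE) !(addr0, add0r).
Qed.

Section Coefficients.
Context {K : fieldType} {A : superspace K}.
Local Notation free := (free_module A).
Local Notation R2 := (polyv (polyv free)).
Local Notation lam := (@pmulX K (polyv free)).
Local Notation mu := (@pmap_coef K (polyv free) (polyv free) (@pmulX K free)).
Local Notation dd := (@pmap_coef K (polyv free) (polyv free)
  (@pmap_coef K free free (free_d A))).
Local Notation cst := (fun u : free => @pconst K (polyv free) (pconst u)).

(** The layers of [R2] are lambda outermost, then mu, then d inside the free module. *)
Definition coef3 p q r (P : R2) : A := (P@_p@_q : free)@_r.

Lemma coef3_linear p q r : linear (coef3 p q r).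
Proof. by move=> c P Q; rewrite /coef3 !(mcoeffD, polyv_scaleE). Qed.

Lemma coef3_lam p q r P :
  coef3 p q r (lam P) = if p is p'.+1 then coef3 p' q r P else 0.
Proof. by rewrite /coef3 pmulXE; case: p => [|p]; rewrite ?mcoeff0. Qed.

Lemma coef3_mu p q r P :
  coef3 p q r (mu P) = if q is q'.+1 then coef3 p q' r P else 0.
Proof.
have mL : linear (@pmulX K free) by apply: pmulX_linear.
rewrite /coef3 pmap_coefE ?(lin0 mL) // pmulXE.
by case: q => [|q]; rewrite ?mcoeff0.
Qed.

Lemma coef3_dd p q r P :
  coef3 p q r (dd P) = if r is r'.+1 then coef3 p q r' P else 0.
Proof.
have dL := @free_d_linear K A; have ddL := pmap_coef_linear dL.
rewrite /coef3 pmap_coefE ?(lin0 ddL) // pmap_coefE ?(lin0 dL) //.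
exact: pmulXE.
Qed.

Lemma coef3_cst p q r u :
  coef3 p q r (cst (pconst u)) = if (p, q, r) is (0, 0, 0)%N then u else 0.
Proof.
rewrite /coef3 pconstE; case: p => [|p]; last by rewrite !mcoeff0.
by rewrite pconstE; case: q => [|q]; rewrite ?mcoeff0 // pconstE.
Qed.

Lemma coef3_expansion (x1 xD xL xM xDD xDL xDM xLL xLM xMM : A) :
    cst (pconst x1) + dd (cst (pconst xD)) + lam (cst (pconst xL))
    + mu (cst (pconst xM)) + dd (dd (cst (pconst xDD)))
    + lam (dd (cst (pconst xDL))) + mu (dd (cst (pconst xDM)))
    + lam (lam (cst (pconst xLL))) + mu (lam (cst (pconst xLM)))
    + mu (mu (cst (pconst xMM))) = 0 ->
  [/\ x1 = 0, xD = 0, xDD = 0 & xLL = 0].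
Proof.
exact: (coefficients_eq0 (E := fun u : A => cst (pconst u)) coef3_linear
  coef3_lam coef3_mu coef3_dd coef3_cst).
Qed.

End Coefficients.

(** * The equivalence *)

Section Equivalence.
Context {K : fieldType} {A : superspace K}.
Variables (lie nov : {bilinear A -> A -> A}) (al : {linear A -> A}).
Hypotheses (lie_even : even_op lie) (nov_even : even_op nov).
Hypothesis al_even : even_map al.

Local Notation free := (free_module A).
Local Notation br := (gd_bracket lie nov).
Local Notation lam := (@pmulX K (polyv free)).
Local Notation mu := (@pmap_coef K (polyv free) (polyv free) (@pmulX K free)).
Local Notation dd := (@pmap_coef K (polyv free) (polyv free)
  (@pmap_coef K free free (free_d A))).
Local Notation cst := (fun u : free => @pconst K (polyv free) (pconst u)).
Local Notation jac := (jacobiator lie nov al lam mu cst).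

Let lamL : linear lam. Proof. exact: pmulX_linear. Qed.
Let muL : linear mu.
Proof. exact: (pmap_coef_linear (@pmulX_linear K free)). Qed.
Let dL := @free_d_linear K A.
Let d1L := pmap_coef_linear dL.
Let ddL : linear dd. Proof. exact: pmap_coef_linear d1L. Qed.
Let cstL : linear cst.
Proof.
exact: (linear_comp_fun
  (@pconst_linear K (polyv free)) (@pconst_linear K free)).
Qed.
Let lam_mu P : lam (mu P) = mu (lam P).
Proof. by rewrite (pmap_coef_mulX P (@pmulX_linear K free)). Qed.
Let dd_lam P : dd (lam P) = lam (dd P). Proof. exact: pmap_coef_mulX. Qed.
Let dd_mu P : dd (mu P) = mu (dd P).
Proof.
have mL := @pmulX_linear K free.
apply/malgP => n.
rewrite !(pmap_coefE _ _ (lin0 d1L), pmap_coefE _ _ (lin0 mL)).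
exact: pmap_coef_mulX.
Qed.
Let cst_d x : cst (free_d A x) = dd (cst x).
Proof. by rewrite (pmap_coef_const _ d1L) (pmap_coef_const _ dL). Qed.

Let jac_const := jacobiator_const lie_even nov_even al_even
  lamL muL ddL cstL lam_mu dd_lam dd_mu cst_d.

Lemma pconst_even i (u : A) : homog i u -> fhomog i (pconst u).
Proof.
by move=> hu n; rewrite pconstE; case: n => [|n] //; apply: homog0.
Qed.

Lemma free_d_even : even_map (free_d A).
Proof.
by move=> i x hx n; rewrite /free_d pmulXE; case: n => [|n] //; apply: homog0.
Qed.

Lemma free_ext_even : even_map (free_ext al).
Proof.
move=> i x hx n; rewrite /free_ext pmap_coefE ?linear0 //.
exact: al_even.
Qed.

Lemma free_quadratic : quadratic (free_d A) br.
Proof.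
have psE : psubst (free_d A) (@pconst K A) =1 id.
  apply: polyv_ind => [|p q Ep Eq|p Ep|v].
  - exact: (lin0 (psubst_linear dL (@pconst_linear K A))).
  - by rewrite (linD (psubst_linear dL (@pconst_linear K A))) Ep Eq.
  - by rewrite psubst_mulX ?Ep //; apply: pconst_linear.
  - by rewrite psubst_const //; apply: pconst_linear.
exists A, (@pconst K A); split.
- exact: pconst_linear.
- exact: pconst_even.
- by exists id => x; rewrite psE.
move=> u v; rewrite gd_bracket_const /gd_bracket_gen.
have addrACA2 (V : lmodType K) (x y z x' y' z' : V) :
    x + y + z + (x' + y' + z') = x + x' + (y + y') + (z + z').
  by zmod.
have regroup (V : lmodType K) (x y z z' : V) :
    x + (y + z) + z' = y + (z + z') + x.
  by zmod.
have pL := @pconst_linear K A; have PL := @pconst_linear K free.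
have E1L := linear_comp_fun (linear_comp_fun PL dL) pL.
have E2L := linear_comp_fun (linear_comp_fun (@pmulX_linear K free) PL) pL.
have E3L := linear_comp_fun PL pL.
(* The bracket of arbitrary vectors is a sum over parities, so the quadratic form is shown to be
   stable under sums and then checked on each homogeneous pair. *)
pose Q P := exists x y z : A, P = pconst (free_d A (pconst x))
  + pmulX (pconst (pconst y)) + pconst (pconst z).
have Q0 : Q 0.
  by exists 0, 0, 0; rewrite (lin0 E1L) (lin0 E2L) (lin0 E3L) !addr0.
have QD P P' : Q P -> Q P' -> Q (P + P').
  move=> [x [y [z ->]]] [x' [y' [z' ->]]]; exists (x + x'), (y + y'), (z + z').
  apply: etrans (addrACA2 (polyv free) _ _ _ _ _ _) _; congr (_ + _ + _).
  - exact/esym/(linD E1L).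
  - exact/esym/(linD E2L).
  - exact/esym/(linD E3L).
apply: (big_ind Q) => // i _; apply: (big_ind Q) => // j _.
move: (hpart i u) (hpart j v) => {}u {}v.
(* These are the coefficients of d, lambda and 1 in the defining formula. *)
exists (nov v u), (nov v u + ssign i j *: nov u v), (lie v u).
apply: etrans (regroup (polyv free) _ _ _ _) _; congr (_ + _ + _).
  exact: (pmap_coef_const _ dL).
have e x y (s : K) :
    pmulX (pconst (pconst (x + s *: y : A)) : polyv free) =
    pmulX (pconst (pconst x)) + s *: pmulX (pconst (pconst y)).
  exact: (etrans (linD E2L _ _) (congr1 _ (linZ E2L _ _))).
exact/esym/e.
Qed.

Lemma conformal_of_gelfand_dorfman :
  super_hom_gelfand_dorfman_bialgebra lie nov al ->
  hom_lie_conformal_superalgebra (free_d A) br (free_ext al).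
Proof.
move=> GD; split.
- exact: dL.
- exact: free_d_even.
- exact: (pmap_coef_linear (linearP al)).
- exact: free_ext_even.
- by move=> x; apply: (pmap_coef_mulX x (linearP al)).
- exact: gd_bracket_bilinear.
- by move=> i j x y _ _; apply: gd_bracket_dl.
- by move=> i j x y _ _; apply: gd_bracket_dr.
- move=> i j x y hx hy; apply/eqP; rewrite -addr_eq0; apply/eqP.
  move: x y hx hy; apply: skew_defect_eq0 => u v hu hv.
  rewrite skew_defect_const // [lie v u](hl_skew (hgd_lie GD) hv hu).
  have -> : ssign j i = ssign i j :> K by rewrite /ssign andbC.
  by rewrite addNr (lin0 (@pconst_linear K A)) (lin0 (@pconst_linear K free)).
- move=> i j k x y z hx hy hz; apply/eqP; rewrite -subr_eq0 opprD addrA.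
  (* The difference of the two sides of the Jacobi identity is [jac] by conversion. *)
  apply/eqP; suff J : forall x y z : free, fhomog i x -> fhomog j y ->
    fhomog k z -> jac (ssign i j) x y z = 0 by apply: (J x y z).
  apply: (jacobiator_eq0 lamL muL ddL cstL lam_mu dd_lam dd_mu cst_d).
  move=> a b c ha hb hc; rewrite (jac_const ha hb hc).
  rewrite (jac1_eq0 lie_even al_even ha hb hc GD).
  rewrite (jacD_eq0 ha hb hc GD) (jacL_eq0 nov_even al_even ha hb hc GD).
  rewrite (jacM_eq0 nov_even al_even ha hb hc GD) (jacDD_eq0 ha hb hc GD).
  rewrite (jacDL_eq0 ha hb hc GD) (jacDM_eq0 ha hb hc GD).
  rewrite (jacLL_eq0 ha hb hc GD) (jacLM_eq0 ha hb hc GD).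
  rewrite (jacMM_eq0 ha hb hc GD).
  rewrite (lin0 (@pconst_linear K A)) (lin0 cstL).
  by rewrite !(lin0 lamL, lin0 muL, lin0 ddL) !addr0.
Qed.

Lemma gelfand_dorfman_of_conformal :
  hom_lie_conformal_superalgebra (free_d A) br (free_ext al) ->
  super_hom_gelfand_dorfman_bialgebra lie nov al.
Proof.
move=> HC.
apply: gelfand_dorfman_of_jac => //.
- move=> i j x y hx hy; apply/eqP; rewrite -addr_eq0; apply/eqP.
  (* The arguments are swapped because the constant term of the bracket of [y] and [x] is
     [lie x y]. *)
  have e : skew_defect (free_d A) br (ssign j i) (pconst y) (pconst x) = 0.
    apply/eqP; rewrite addr_eq0; apply/eqP.
    exact: (hlc_skew HC (pconst_even hy) (pconst_even hx)).
  rewrite skew_defect_const // in e.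
  have := congr1 (fun P : polyv free => (P@_0%N : free)@_0%N) e.
  by rewrite !pconstE !mcoeff0 /ssign [j && i]andbC.
- move=> i j k a b c ha hb hc.
  have e : jac (ssign i j) (pconst a) (pconst b) (pconst c) = 0.
    apply/eqP; rewrite /jacobiator -addrA -opprD subr_eq0; apply/eqP.
    exact: (hlc_jacobi HC (pconst_even ha) (pconst_even hb)
      (pconst_even hc)).
  move: e; rewrite (jac_const ha hb hc); exact: coef3_expansion.
Qed.

End Equivalence.

Theorem theorem4p10 (R : realType) (A : superspace R[i])
    (lie nov : {bilinear A -> A -> A}) (alpha : {linear A -> A})
    (lie_even : even_op lie) (nov_even : even_op nov)
    (alpha_even : even_map alpha) :
  quadratic_hom_lie_conformal_superalgebra
    (free_d A) (gd_bracket lie nov) (free_ext alpha)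
  <-> super_hom_gelfand_dorfman_bialgebra lie nov alpha.
Proof.
split=> [[HC _]|GD]; first exact: gelfand_dorfman_of_conformal HC.
by split; [apply: conformal_of_gelfand_dorfman | apply: free_quadratic].
Qed.
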